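(* Consider the white noise model or the Gaussian sequence model with noise level $n^{-1/2}$, let $T$ be a linear functional and let $\mathcal{F}$ be a parameter set. Then $$R_A^*(n;\mathcal{F})=\sup_{\varepsilon>0}\ \omega^2\big(\varepsilon,\mathrm{C.Hull}(\mathcal{F})\big)\,\frac{1/(4n)}{1/n+\varepsilon^2/4}$$ and $$\frac18\,\omega^2\Big(\frac2{\sqrt n},\mathrm{C.Hull}(\mathcal{F})\Big)\le R_A^*(n;\mathcal{F})\le\frac14\,\omega^2\Big(\frac2{\sqrt n},\mathrm{C.Hull}(\mathcal{F})\Big).$$
   Context: White noise model: one observes $dY(t)=f(t)\,dt+n^{-1/2}dW(t)$ on an interval, $W$ a standard Brownian motion. Sequence model: one observes $Y(i)=f(i)+n^{-1/2}\varepsilon_i$, $\varepsilon_i$ i.i.d. standard normal. $\|\cdot\|_2$ is the $L_2$ (resp. $\ell_2$) norm; parameter sets are subsets of $L_2$ (resp. $\ell_2$), and $T$ is a linear functional on a linear space containing the parameter set. A linear (affine) estimator has the form $\hat T=a+\int u(t)\,dY(t)$, resp. $\hat T=a+\sum_i u(i)Y(i)$, with $a\in\mathbb{R}$ and $u$ in $L_2$ (resp. $\ell_2$). The minimax linear risk is $R_A^*(n;\mathcal{F})=\inf_{\hat T}\sup_{f\in\mathcal{F}}E_f(\hat T-Tf)^2$, the infimum being over all linear (affine) estimators. $\mathrm{C.Hull}(\mathcal{F})$ is the convex hull of $\mathcal{F}$. The modulus of continuity is $\omega(\varepsilon,\mathcal{H})=\sup\{|T(g)-T(f)|:\|g-f\|_2\le\varepsilon,\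 f\in\mathcal{H},\ g\in\mathcal{H}\}$. *)

(* Defs.v *)
From mathcomp Require Import all_boot all_order all_algebra.
From mathcomp Require Import all_classical all_reals all_analysis.

Set Implicit Arguments.
Unset Strict Implicit.
Unset Printing Implicit Defensive.
Import Order.TTheory GRing.Theory Num.Theory.
Import numFieldNormedType.Exports.

Local Open Scope classical_set_scope.
Local Open Scope ring_scope.

Section linear_minimax.
Context {R : realType} {V : lmodType R}.
Implicit Types (D F H : set V) (T : V -> R).

(* [T] is a linear functional on the linear space [D]; its values outside [D]
   are irrelevant. *)
Definition linear_functional_on D T : Prop :=
  [/\ D 0,
      forall (a : R) (f g : V), D f -> D g -> D (a *: f + g) &
      forall (a : R) (f g : V), D f -> D g -> T (a *: f + g) = a * T f + T g].

Definition convex_hull F : set V := smallest (@convex_set R V) F.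

(* [nrm] is the L_2 (or l_2) norm, which is only a seminorm on functions. *)
Definition modulus (nrm : V -> \bar R) T (e : R) H : \bar R :=
  ereal_sup [set y | exists f g : V,
    [/\ H f, H g, (nrm (g - f)%R <= e%:E)%E & y = `|T g - T f|%:E]].

Context {d : measure_display} {Omega : measurableType d}.
Variable P : probability Omega R.

(* An estimator is represented by its values under all the parameters:
   [That f] is the estimator evaluated on the data generated by [f].
   [stat f u X] says that [X] is a version of the linear statistic with weight
   [u] (the integral of [u] against dY, or the sum of the u(i) Y(i)) of the
   data generated by [f], and [L] is the space of admissible weights.  The
   constant [a] and the weight [u] do not depend on [f]. *)
Definition affine_estimators (L : set V)
    (stat : V -> V -> {RV P >-> R} -> Prop) F : set (V -> {RV P >-> R}) :=
  [set That | exists (a : R) (u : V), L u /\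
    forall f, F f -> exists2 X : {RV P >-> R}, stat f u X &
      {ae P, forall w, That f w = a + X w}].

Definition max_risk T F (That : V -> {RV P >-> R}) : \bar R :=
  ereal_sup [set ('E_P[fun w => ((That f w - T f) ^+ 2)%R])%E | f in F].

Definition minimax_affine_risk (L : set V)
    (stat : V -> V -> {RV P >-> R} -> Prop) T F : \bar R :=
  ereal_inf [set max_risk T F That | That in affine_estimators L stat F].

Definition mean_square_cvg (S : nat -> Omega -> R) (X : Omega -> R) : Prop :=
  ('E_P[fun w => ((S k w - X w) ^+ 2)%R])%E @[k --> \oo] --> 0%E.

(* Taking some of the [A i] equal to [setT] gives the product rule for every
   subfamily. *)
Definition independent_RVs (k : nat) (X : nat -> Omega -> R) : Prop :=
  forall A : nat -> set R, (forall i, measurable (A i)) ->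
    P (\bigcap_(i < k) (X i @^-1` A i)) = (\prod_(i < k) P (X i @^-1` A i))%E.

Definition iid_standard_normal (eps : nat -> {RV P >-> R}) : Prop :=
  (forall i A, measurable A -> distribution P (eps i) A = normal_prob 0 1 A) /\
  (forall k, independent_RVs k eps).

(* Standard Brownian motion indexed by an arbitrary interval [I], started at
   some point [t0] of [I] (two-sided if [t0] is interior).  Equal times are
   excluded from the Gaussian clause because [normal_prob 0 0] is not the Dirac
   mass at 0. *)
Definition brownian_motion (I : interval R) (W : R -> {RV P >-> R}) : Prop :=
  [/\ exists2 t0, t0 \in I & {ae P, forall w, W t0 w = 0},
      forall s t, s \in I -> t \in I -> s < t -> forall A, measurable A ->
        pushforward P (W t \- W s) A =
        normal_prob 0 (Num.sqrt (t - s)) A,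
      forall (k : nat) (t : nat -> R),
        (forall i, (i <= k)%N -> t i \in I) ->
        (forall i, (i < k)%N -> t i <= t i.+1) ->
        independent_RVs k (fun i => W (t i.+1) \- W (t i)) &
      {ae P, forall w, {within [set` I], continuous (fun t => W t w)}}].

End linear_minimax.

Section white_noise.
Context {R : realType}.
Implicit Types (I : interval R) (f u : R -> R^o).
Local Notation mu := (@lebesgue_measure R).

(* Functions on [I] are represented by functions on [R] whose values outside
   [I] are irrelevant. *)
Definition L2 I : set (R -> R^o) :=
  [set f | (f \_ [set` I] : R -> R) \in Lfun mu 2%:E].

Definition L2norm I f : \bar R := 'N[mu]_2%:E[EFin \o (f \_ [set` I])]%E.

(* A list of triples (c, s, t) encodes the step function equal to the sum of
   the c 1_]s, t], with all the end points in [I]. *)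
Definition step_in I (S : seq (R * R * R)) : bool :=
  all (fun p => [&& p.1.2 \in I, p.2 \in I & p.1.2 <= p.2]) S.

Definition step_fun (S : seq (R * R * R)) : R -> R^o :=
  fun x => \sum_(p <- S) p.1.1 * \1_(`]p.1.2, p.2]%classic) x.

Context {d : measure_display} {Omega : measurableType d}.
Variables (P : probability Omega R) (n : R) (W : R -> {RV P >-> R}).

(* Y(t) - Y(s) for s <= t, where dY(t) = f(t) dt + n^(-1/2) dW(t). *)
Definition white_noise_incr f (s t : R) : Omega -> R :=
  fun w => \int[mu]_(x in `]s, t]) f x + (Num.sqrt n)^-1 * (W t w - W s w).

Definition step_integral f (S : seq (R * R * R)) : Omega -> R :=
  fun w => \sum_(p <- S) p.1.1 * white_noise_incr f p.1.2 p.2 w.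

(* [X] is a version of the stochastic integral of [u] against dY. *)
Definition white_noise_integral I f u (X : {RV P >-> R}) : Prop :=
  exists S : nat -> seq (R * R * R),
    [/\ forall k, step_in I (S k),
        L2norm I (u - step_fun (S k)) @[k --> \oo] --> 0%E &
        mean_square_cvg P (fun k => step_integral f (S k)) X].

End white_noise.

Section gaussian_sequence.
Context {R : realType}.
Implicit Types f u : nat -> R^o.

Definition ell2 : set (nat -> R^o) :=
  [set f | (f : nat -> R) \in Lfun counting 2%:E].

Definition ell2norm f : \bar R := 'N[counting]_2%:E[EFin \o f]%E.

Context {d : measure_display} {Omega : measurableType d}.
Variables (P : probability Omega R) (n : R) (eps : nat -> {RV P >-> R}).

Definition sequence_obs f (i : nat) : Omega -> R :=
  fun w => f i + (Num.sqrt n)^-1 * eps i w.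

(* [X] is a version of the sum of the series of the u(i) Y(i). *)
Definition sequence_sum f u (X : {RV P >-> R}) : Prop :=
  mean_square_cvg P (fun k w => \sum_(i < k) u i * sequence_obs f i w) X.

End gaussian_sequence.

(* Main.v *)
(* An affine estimator with weight [u] has risk
   [(a + <u, f> - T f)^2 + |u|^2 / n] at [f].  As a function of [f] the bias is
   affine, so the worst case over [F] is the worst case over the convex hull [H],
   and the best constant [a] leaves half the oscillation of [T - <u, .>] on [H].
   Writing [K = H - H], both sides are governed by the condition
   [(T h)^2 <= M (4 + n |h|^2)] for all [h] in [K].  If an estimator has maximal
   risk [M], Cauchy-Schwarz gives the condition.  Conversely, the condition says
   that [T] is bounded by [sqrt M] times a Hilbert norm on the cone generated by
   [{1} x K] in [R x L_2]; representing it from above by a vector of norm at most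
   [sqrt M] yields [Delta] and [u] with [T h <= <u, h> + Delta] on [K] and
   [Delta^2 / 4 + |u|^2 / n <= M].  No compactness of [F] enters, only the
   completeness of [L_2].  The two-sided bound follows from [n e^2 = 4] at
   [e = 2 / sqrt n] and from [omega e <= (e / e0) omega e0] for [e >= e0], which
   is the convexity of [H]. *)

Require Import Defs.
From mathcomp Require Import all_boot all_order all_algebra.
From mathcomp Require Import all_classical all_reals all_analysis.
From mathcomp Require Import measurable_realfun.
From mathcomp Require Import ring lra.

Set Implicit Arguments.
Unset Strict Implicit.
Unset Printing Implicit Defensive.
Import Order.TTheory GRing.Theory Num.Theory.
Import numFieldNormedType.Exports.

Local Open Scope classical_set_scope.
Local Open Scope ring_scope.

(** * Semi-inner product spaces *)

Section semi_inner_product.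
Context {R : realType} {V : lmodType R}.
Implicit Types (L C K D : set V) (ip : V -> V -> R).

(** The obstacle is that [T] is linear only on [D] and may be unbounded for the norm: it has no
    Riesz representation to start from, and no limit can be taken inside [T]. What is known is a
    quadratic bound on a cone, and a maximization over that cone only ever compares values of [T] at
    its points. A one-sided majorant is enough because [K] contains [f - g] together with [g - f].
    The constant 4 comes from the bias: between two points whose bias is at most [q], the biases
    account for [2 q] of the increment of [T]. Both models share one argument, in a complete
    semi-inner product space where linear statistics exist and have the expected mean and variance.
    The form is only semidefinite because functions that agree almost everywhere are not identified.
    Symmetry and positivity are required of all vectors, since the integral has them without
    integrability. *)

Record semi_inner_product L ip : Prop := SemiInnerProduct {
  sip0 : L 0;
  sipP : forall a f g, L f -> L g -> L (a *: f + g);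
  sipC : forall f g, ip f g = ip g f;
  sipDZ : forall a f g h, L f -> L g -> L h ->
    ip (a *: f + g) h = a * ip f h + ip g h;
  sip_ge0 : forall f, 0 <= ip f f }.

Definition sip_cvg ip (x : nat -> V) (l : V) : Prop :=
  ip (x k - l) (x k - l) @[k --> \oo] --> (0 : R).

Definition sip_cauchy ip (x : nat -> V) : Prop :=
  forall e : R, 0 < e -> exists N, forall k l, (N <= k)%N -> (N <= l)%N ->
    ip (x k - x l) (x k - x l) <= e.

Definition sip_complete L ip : Prop := forall x : nat -> V,
  (forall k, L (x k)) -> sip_cauchy ip x -> exists2 l, L l & sip_cvg ip x l.

Section theory.
Variables (L : set V) (ip : V -> V -> R).
Hypothesis HL : semi_inner_product L ip.

Lemma sipZ a f : L f -> L (a *: f).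
Proof.
by move=> Lf; rewrite -[a *: f]addr0; apply: (sipP HL) => //; exact: (sip0 HL).
Qed.

Lemma sipD f g : L f -> L g -> L (f + g).
Proof. by move=> Lf Lg; rewrite -[f]scale1r; exact: (sipP HL). Qed.

Lemma sipB f g : L f -> L g -> L (f - g).
Proof. by move=> Lf Lg; rewrite addrC -scaleN1r; exact: (sipP HL). Qed.

Lemma ip0l h : L h -> ip 0 h = 0.
Proof.
move=> Lh; have := sipDZ HL 1 (sip0 HL) (sip0 HL) Lh.
by rewrite scale1r addr0 mul1r; lra.
Qed.

Lemma ipZl a f h : L f -> L h -> ip (a *: f) h = a * ip f h.
Proof.
by move=> Lf Lh; rewrite -[a *: f]addr0 (sipDZ HL)// ?ip0l ?addr0//; exact: (sip0 HL).
Qed.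

Lemma ipDl f g h : L f -> L g -> L h -> ip (f + g) h = ip f h + ip g h.
Proof. by move=> Lf Lg Lh; rewrite -[f]scale1r (sipDZ HL)// mul1r scale1r. Qed.

Lemma ipBl f g h : L f -> L g -> L h -> ip (f - g) h = ip f h - ip g h.
Proof.
by move=> Lf Lg Lh; rewrite addrC -scaleN1r (sipDZ HL)// mulN1r addrC.
Qed.

Lemma ipZr a f h : L f -> L h -> ip h (a *: f) = a * ip h f.
Proof. by move=> Lf Lh; rewrite (sipC HL) ipZl// (sipC HL). Qed.

Lemma ipDr f g h : L f -> L g -> L h -> ip h (f + g) = ip h f + ip h g.
Proof. by move=> *; rewrite (sipC HL) ipDl// !(sipC HL h). Qed.

Lemma ipBr f g h : L f -> L g -> L h -> ip h (f - g) = ip h f - ip h g.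
Proof. by move=> *; rewrite (sipC HL) ipBl// !(sipC HL h). Qed.

Lemma ip_sqrB f g : L f -> L g -> ip (f - g) (f - g) = ip f f - 2 * ip f g + ip g g.
Proof.
move=> Lf Lg; have Lfg := sipB Lf Lg.
rewrite ipBl// !ipBr// (sipC HL g f); ring.
Qed.

Lemma ip_sqrD f g : L f -> L g -> ip (f + g) (f + g) = ip f f + 2 * ip f g + ip g g.
Proof.
move=> Lf Lg; have Lfg := sipD Lf Lg.
rewrite ipDl// !ipDr// (sipC HL g f); ring.
Qed.

Lemma cauchy_schwarz f g : L f -> L g -> ip f g ^+ 2 <= ip f f * ip g g.
Proof.
move=> Lf Lg.
have key a : 0 <= a ^+ 2 * ip f f - 2 * a * ip f g + ip g g.
  have := sip_ge0 HL (a *: f - g).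
  by rewrite (ip_sqrB (sipZ a Lf) Lg) !ipZl// ?ipZr//; [|exact: sipZ]; lra.
have ff0 := sip_ge0 HL f; have gg0 := sip_ge0 HL g.
have [ff|ffN] := eqVneq (ip f f) 0.
  rewrite ff mul0r; have [->|fgN] := eqVneq (ip f g) 0; first by rewrite expr0n.
  (* When [|f|^2 = 0] the quadratic in [key] is affine in [a]; this [a] gives it the value -1. *)
  have := key ((ip g g + 1) / (2 * ip f g)).
  rewrite ff mulr0 sub0r.
  have -> : 2 * ((ip g g + 1) / (2 * ip f g)) * ip f g = ip g g + 1 by field.
  lra.
have := key (ip f g / ip f f).
have -> : (ip f g / ip f f) ^+ 2 * ip f f - 2 * (ip f g / ip f f) * ip f g + ip g g
  = (ip f f * ip g g - ip f g ^+ 2) / ip f f by field.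
by rewrite pmulr_lge0 ?invr_gt0 ?lt_def ?ffN// subr_ge0.
Qed.

Lemma cauchy_schwarz_sqrt f g : L f -> L g ->
  `|ip f g| <= Num.sqrt (ip f f) * Num.sqrt (ip g g).
Proof.
move=> Lf Lg; rewrite -sqrtr_sqr -sqrtrM ?(sip_ge0 HL)//.
by apply: ler_wsqrtr; exact: cauchy_schwarz.
Qed.

Lemma sip_cvg_ip (x y : nat -> V) (l m : V) :
  (forall k, L (x k)) -> (forall k, L (y k)) -> L l -> L m ->
  sip_cvg ip x l -> sip_cvg ip y m -> ip (x k) (y k) @[k --> \oo] --> ip l m.
Proof.
move=> Lx Ly Ll Lm xl ym.
have sq (z : nat -> V) w : sip_cvg ip z w ->
    Num.sqrt (ip (z k - w) (z k - w)) @[k --> \oo] --> (0 : R).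
  by move=> zw; rewrite -(sqrtr0 R); apply: continuous_cvg => //; exact: sqrt_continuous.
have sx := sq _ _ xl; have sy := sq _ _ ym.
pose b k := Num.sqrt (ip (x k - l) (x k - l)) * Num.sqrt (ip (y k - m) (y k - m))
  + Num.sqrt (ip (x k - l) (x k - l)) * Num.sqrt (ip m m)
  + Num.sqrt (ip l l) * Num.sqrt (ip (y k - m) (y k - m)).
have b0 : b k @[k --> \oo] --> (0 : R).
  have -> : (0 : R) = 0 * 0 + 0 * Num.sqrt (ip m m) + Num.sqrt (ip l l) * 0 by ring.
  apply: cvgD; first apply: cvgD.
  - exact: cvgM.
  - by apply: cvgM => //; exact: cvg_cst.
  - by apply: cvgM => //; exact: cvg_cst.
suff H k : `|ip (x k) (y k) - ip l m| <= b k.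
  apply/cvgrPdist_le => e e0; move/cvgrPdist_le: b0 => /(_ e e0).
  apply: filterS => k; rewrite sub0r normrN => be.
  by rewrite distrC (le_trans (H k))// (le_trans _ be)// ler_norm.
have Lxl := sipB (Lx k) Ll; have Lym := sipB (Ly k) Lm.
have -> : ip (x k) (y k) - ip l m
    = ip (x k - l) (y k - m) + ip (x k - l) m + ip l (y k - m).
  by rewrite !ipBr// !ipBl//; ring.
apply: (le_trans (ler_normD _ _)); apply: lerD; last exact: cauchy_schwarz_sqrt.
by apply: (le_trans (ler_normD _ _)); apply: lerD; exact: cauchy_schwarz_sqrt.
Qed.

Lemma sip_cvg_cst l : L l -> sip_cvg ip (fun=> l) l.
Proof.
by move=> Ll; rewrite /sip_cvg subrr ip0l; [exact: cvg_cst|exact: (sip0 HL)].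
Qed.

Lemma sip_cvg_cauchy (x : nat -> V) l : (forall k, L (x k)) -> L l ->
  sip_cvg ip x l -> sip_cauchy ip x.
Proof.
move=> Lx Ll xl e e0; move/cvgrPdist_le: xl => /(_ (e / 4)).
rewrite divr_gt0// => /(_ isT) [N _ HN]; exists N => k m Nk Nm.
have := HN k Nk; have := HN m Nm; rewrite /= !sub0r !normrN.
rewrite !ger0_norm ?(sip_ge0 HL)// => mb kb.
have Lk := sipB (Lx k) Ll; have Lm := sipB (Lx m) Ll.
have -> : x k - x m = (x k - l) - (x m - l) by rewrite opprB addrA subrK.
rewrite ip_sqrB//.
(* [|a - b|^2 <= 2 |a|^2 + 2 |b|^2], since [|a + b|^2 >= 0]; hence the threshold [e / 4]. *)
by have := sip_ge0 HL ((x k - l) + (x m - l)); rewrite ip_sqrD//; lra.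
Qed.

(* Near-maximizers [y] of [2 tau y - |y|^2] over the cone form a Cauchy
   sequence by the parallelogram identity; the first-order conditions at their
   limit say that it represents [tau] from above. *)
Lemma cone_representer C (tau : V -> R) (M : R) : sip_complete L ip ->
  C `<=` L -> C 0 -> (forall f g, C f -> C g -> C (f + g)) ->
  (forall (a : R) f, 0 <= a -> C f -> C (a *: f)) ->
  (forall f g, C f -> C g -> tau (f + g) = tau f + tau g) ->
  (forall (a : R) f, 0 <= a -> C f -> tau (a *: f) = a * tau f) ->
  (forall f, C f -> 2 * tau f - ip f f <= M) ->
  exists z, [/\ L z, forall f, C f -> tau f <= ip z f, ip z z <= M &
    exists2 x, (forall k, C (x k)) & sip_cvg ip x z].
Proof.
move=> cL CL C0 CD CZ tD tZ HM.
pose q f := 2 * tau f - ip f f.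
have q0 : q 0 = 0.
  rewrite /q ip0l; last exact: (sip0 HL).
  by have := tZ 0 0 (lexx _) C0; rewrite scale0r mul0r => ->; rewrite mulr0 subr0.
pose Q := q @` C.
have supQ : has_sup Q.
  by split; [exists (q 0); exists 0|exists M => _ [f Cf <-]; exact: HM].
pose s := sup Q.
have qs f : C f -> q f <= s by move=> Cf; apply: ub_le_sup; [exact: supQ.2|exists f].
have sM : s <= M by apply: ge_sup; [exact: supQ.1|move=> _ [f Cf <-]; exact: HM].
have /choice[x xP] : forall k, exists y, C y /\ s - k.+1%:R^-1 < q y.
  move=> k.
  have k0 : 0 < k.+1%:R^-1 :> R by rewrite invr_gt0.
  have [_ [f Cf <-] sf] := sup_adherent k0 supQ.
  by exists f.
have Cx k := (xP k).1; have qx k : s - k.+1%:R^-1 < q (x k) := (xP k).2.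
have Lx k : L (x k) by exact/CL.
have inv0 : k.+1%:R^-1 @[k --> \oo] --> (0 : R) by exact: cvg_harmonic.
have cx : sip_cauchy ip x.
  move=> e e0; move/cvgrPdist_le: inv0 => /(_ (e / 4)).
  rewrite divr_gt0// => /(_ isT) [N _ HN]; exists N => k m Nk Nm.
  have := HN k Nk; have := HN m Nm; rewrite /= !sub0r !normrN.
  rewrite !ger0_norm ?invr_ge0// => mb kb.
  (* At the midpoint, [q ((x k + x m) / 2) = (q (x k) + q (x m)) / 2 + |x k - x m|^2 / 4], and
     [q <= s] there. *)
  have := qs _ (CZ 2^-1 _ _ (CD _ _ (Cx k) (Cx m))).
  rewrite invr_ge0 ler0n => /(_ isT); have := qx k; have := qx m.
  rewrite /q tZ ?invr_ge0//; last exact: CD.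
  have Lkm : L (x k + x m) by exact: sipD.
  have L2km := sipZ 2^-1 Lkm; rewrite tD// ipZl// ipZr//.
  rewrite ip_sqrD// ip_sqrB//.
  move: (k.+1%:R^-1) (m.+1%:R^-1) mb kb => dk dm mb kb; lra.
have [z Lz xz] := cL _ Lx cx; exists z; split => //; last by exists x.
- move=> f Cf; have Lf := CL _ Cf.
  apply/ler_addgt0Pr => e e0.
  pose t := e / (ip f f + 1).
  have ff0 := sip_ge0 HL f.
  have t0 : 0 < t by rewrite divr_gt0// ltr_wpDl.
  have tf : t * ip f f <= e.
    by rewrite /t mulrAC ler_pdivrMr ?ltr_wpDl// ler_pM2l//; lra.
  (* Compares [q (x k + t f) <= s] with [q (x k) > s - 1 / (k + 1)] and divides by [t]. The term
     [tau (x k)] cancels, so the limit in [k] only involves [ip]. *)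
  have main k : 2 * tau f <= 2 * ip (x k) f + t * ip f f + t^-1 * k.+1%:R^-1.
    have Ctf := CZ t _ (ltW t0) Cf; have Ltf := sipZ t Lf.
    have := qs _ (CD _ _ (Cx k) Ctf); have := qx k.
    rewrite /q tD// (tZ _ _ (ltW t0))// ip_sqrD// !ipZr// ipZl//.
    have -> : t^-1 * k.+1%:R^-1 = k.+1%:R^-1 / t by rewrite mulrC.
    rewrite -lerBlDl ler_pdivlMr//.
    move: (k.+1%:R^-1) => dk h1 h2; lra.
  have lim1 : 2 * ip (x k) f + t * ip f f + t^-1 * k.+1%:R^-1 @[k --> \oo]
      --> 2 * ip z f + t * ip f f + t^-1 * 0.
    apply: cvgD; [apply: cvgD|]; [|exact: cvg_cst|].
    - apply: cvgM; first exact: cvg_cst.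
      by apply: sip_cvg_ip => //; exact: sip_cvg_cst.
    - by apply: cvgM => //; exact: cvg_cst.
  have : 2 * tau f <= 2 * ip z f + t * ip f f + t^-1 * 0.
    by apply: (cvgr_to_ge lim1); exact: nearW.
  by rewrite mulr0; lra.
- apply: le_trans sM; apply/ler_addgt0Pr => e e0.
  have zz0 := sip_ge0 HL z.
  have lim : ip (x k) (x k) @[k --> \oo] --> ip z z by exact: sip_cvg_ip.
  (* Compares [q ((1 - t) x k) <= s] with the near-maximality of [x k]. Again [tau (x k)] is
     eliminated, and [|x k|^2] exceeds [s] only by terms that vanish as [k] grows and then [t] tends
     to 0. *)
  have main t k : 0 < t -> t < 1 ->
      (1 - t) * ip (x k) (x k) - (1 - t) / t * k.+1%:R^-1 <= s.
    move=> t0 t1; have u0 : 0 <= 1 - t by lra.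
    have := qs _ (CZ (1 - t) _ u0 (Cx k)); have := qx k.
    rewrite /q tZ// ipZl ?ipZr//; last exact: sipZ.
    move=> h1 h2; rewrite -(ler_pM2l t0) mulrBr.
    have -> : t * ((1 - t) / t * k.+1%:R^-1) = (1 - t) * k.+1%:R^-1.
      by field; rewrite gt_eqF// gt_eqF.
    have : (1 - t) * (s - k.+1%:R^-1) <= (1 - t) * (2 * tau (x k) - ip (x k) (x k)).
      by apply: ler_wpM2l => //; exact: ltW.
    by move: (k.+1%:R^-1) h1 => dk h1; nra.
  pose t := Num.min 2^-1 (e / (ip z z + 1)).
  have t0 : 0 < t by rewrite lt_min invr_gt0 ltr0n/= divr_gt0// ltr_wpDl.
  have t1 : t < 1 by rewrite gt_min; apply/orP; left; rewrite invf_lt1// ltr1n.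
  have te : t * ip z z <= e.
    apply: (@le_trans _ _ (e / (ip z z + 1) * ip z z)).
      by apply: ler_wpM2r => //; rewrite ge_min lexx orbT.
    by rewrite mulrAC ler_pdivrMr ?ltr_wpDl// ler_pM2l//; lra.
  have lim2 : (1 - t) * ip (x k) (x k) - (1 - t) / t * k.+1%:R^-1 @[k --> \oo]
      --> (1 - t) * ip z z - (1 - t) / t * 0.
    by apply: cvgB; apply: cvgM => //; exact: cvg_cst.
  have : (1 - t) * ip z z - (1 - t) / t * 0 <= s.
    by apply: (cvgr_to_le lim2); apply: nearW => k; exact: main.
  by rewrite mulr0; lra.
Qed.

End theory.
End semi_inner_product.

(** * Affine majorants of a functional on a convex set *)

Section affine_majorant.
Context {R : realType} {V : lmodType R}.
Variables (L : set V) (ip : V -> V -> R) (n : R).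
Hypotheses (HL : semi_inner_product L ip) (n0 : 0 < n).

(** The squared norm of [(1, h)] is [4 + n |h|^2], the factor of [M] in the bound on [(T h)^2]. *)
Definition weighted_ip (p q : R^o * V) : R := 4 * (p.1 * q.1) + n * ip p.2 q.2.

Lemma weighted_sip : semi_inner_product [set p : R^o * V | L p.2] weighted_ip.
Proof.
split => /=.
- exact: (sip0 HL).
- by move=> a f g /= Lf Lg; exact: (sipP HL).
- by move=> f g; rewrite /weighted_ip mulrC (sipC HL); congr (_ + _); ring.
- move=> a f g h /= Lf Lg Lh; rewrite /weighted_ip /= (sipDZ HL)// /GRing.scale/=.
  ring.
- move=> f; rewrite /weighted_ip addr_ge0// mulr_ge0// ?(sip_ge0 HL)//.
  + exact: sqr_ge0.
  + exact: ltW.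
Qed.

Lemma weighted_complete : sip_complete L ip ->
  sip_complete [set p : R^o * V | L p.2] weighted_ip.
Proof.
move=> cL x Lx cx.
have n0' := ltW n0.
have cx2 : sip_cauchy ip (snd \o x).
  move=> e e0; have [N HN] := cx (n * e) (mulr_gt0 n0 e0).
  exists N => k l Nk Nl; have := HN k l Nk Nl; rewrite /weighted_ip/= => h.
  rewrite -(ler_pM2l n0); apply: le_trans h; rewrite lerDr mulr_ge0//.
  exact: sqr_ge0.
have [z2 Lz2 xz2] := cL (snd \o x) Lx cx2.
have cx1 : cvgn (fun k => (x k).1 : R).
  apply: cauchy_cvg; apply: cauchy_exP => e e0.
  have [N HN] := cx (e ^+ 2) (exprn_gt0 2 e0).
  exists (x N).1; exists N => // k /= Nk; rewrite -ball_normE /=.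
  have := HN N k (leqnn N) Nk; rewrite /weighted_ip/= => h.
  have {}h : 4 * ((x N).1 - (x k).1 : R) ^+ 2 <= e ^+ 2.
    by rewrite expr2; apply: le_trans h; rewrite lerDl mulr_ge0// (sip_ge0 HL).
  rewrite -(ltr_pXn2r (n := 2))// ?nnegrE ?ltW// real_normK ?num_real//.
  have := sqr_ge0 ((x N).1 - (x k).1 : R); have := exprn_gt0 2 e0.
  by move: (_ ^+ 2) (e ^+ 2) h => a b; lra.
exists (limn (fun k => (x k).1 : R), z2) => //.
rewrite /sip_cvg /weighted_ip /=.
have -> : (0 : R) = 4 * (0 * 0) + n * 0 by ring.
have l1 : (x k).1 - limn (fun k => (x k).1 : R) @[k --> \oo] --> (0 : R).
  by rewrite -(subrr (limn (fun k => (x k).1 : R))); apply: cvgB => //; exact: cvg_cst.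
apply: cvgD; first by apply: cvgM; [exact: cvg_cst|exact: cvgM].
by apply: cvgM; [exact: cvg_cst|exact: xz2].
Qed.

(* [T] is bounded by [sqrt M] times the weighted norm on the cone generated by
   the points [(1, k)]; a representer [(a, w)] yields [Delta = 4 a], [u = n w]. *)
Lemma affine_majorant (D K : set V) (T : V -> R) (M : R) :
  sip_complete L ip -> linear_functional_on D T ->
  K !=set0 -> K `<=` L -> K `<=` D ->
  (forall (t : R) f g, 0 <= t <= 1 -> K f -> K g -> K (t *: f + (1 - t) *: g)) ->
  (forall h, K h -> T h ^+ 2 <= M * (4 + n * ip h h)) ->
  exists Delta u, [/\ L u, forall h, K h -> T h <= ip u h + Delta &
    Delta ^+ 2 / 4 + ip u u / n <= M].
Proof.
move=> cL [D0 DP TP] [k0 Kk0] KL KD Kcvx HM.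
have DZ a f : D f -> D (a *: f) by move=> Df; rewrite -[_ *: _]addr0; exact: DP.
have T0 : T 0 = 0 by have := TP 1 0 0 D0 D0; rewrite scale1r addr0 mul1r; lra.
have TZ a f : D f -> T (a *: f) = a * T f.
  by move=> Df; rewrite -[_ *: _]addr0 TP// T0 addr0.
have TD f g : D f -> D g -> T (f + g) = T f + T g.
  by move=> Df Dg; rewrite -[f in LHS]scale1r TP// mul1r.
pose C : set (R^o * V) := [set p | 0 <= (p.1 : R) /\ exists2 k, K k & p.2 = p.1 *: k].
have CD (f g : R^o * V) : C f -> C g -> C (f + g).
  move=> [f0 [k Kk fk]] [g0 [l Kl gl]].
  rewrite /C /= fk gl; split; first exact: addr_ge0.
  (* If the first coordinates sum to 0, both vectors are 0. Otherwise [a (1, k) + b (1, l)] is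
     [a + b] times [(1, m)], with [m] a barycentre of [k] and [l], which convexity puts in [K]. *)
  have [fg0|fgN] := eqVneq ((f.1 : R) + g.1) 0.
    have f10 : f.1 = 0 :> R by move: fg0 f0 g0; lra.
    have g10 : g.1 = 0 :> R by move: fg0 f0 g0; lra.
    by exists k => //; rewrite f10 g10 addr0 !scale0r addr0.
  have fg0 : 0 < (f.1 : R) + g.1 by rewrite lt_def fgN addr_ge0.
  exists ((f.1 / (f.1 + g.1) : R) *: k + (1 - (f.1 / (f.1 + g.1) : R)) *: l).
    apply: Kcvx => //; rewrite divr_ge0 ?(ltW fg0)//= ler_pdivrMr// mul1r lerDl//.
  rewrite scalerDr !scalerA; congr (_ *: _ + _ *: _); field; exact: fgN.
have CZ (a : R) (f : R^o * V) : 0 <= a -> C f -> C (a *: f).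
  move=> a0 [f0 [k Kk fk]]; split => /=; first exact: mulr_ge0.
  by exists k => //; rewrite fk scalerA.
have C0 : C 0 by split => //=; exists k0 => //; rewrite scale0r.
have CD2 (f : R^o * V) : C f -> D f.2 by move=> [_ [k Kk ->]]; apply/DZ/KD.
have CL (f : R^o * V) : C f -> L f.2 by move=> [_ [k Kk ->]]; apply: (sipZ HL); exact: KL.
have [|||z [Lz Hz zM _]] := @cone_representer R _ _ _ weighted_sip C (T \o snd) M
    (weighted_complete cL) CL C0 CD CZ.
- by move=> f g Cf Cg /=; rewrite TD//; exact: CD2.
- by move=> a f a0 Cf /=; rewrite TZ//; exact: CD2.
- move=> f [f0 [k Kk fk]]; rewrite /weighted_ip /= fk.
  rewrite TZ; last exact: KD.
  have Lk := KL _ Kk.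
  rewrite (ipZl HL)//; last exact: (sipZ HL).
  rewrite (ipZr HL)//.
  have := HM _ Kk; have := sip_ge0 HL k; set c := (f.1 : R); set t := T k.
  set N := ip k k => N0 h.
  have : 0 < 4 + n * N by rewrite ltr_wpDr// mulr_ge0// ltW.
  set S := 4 + n * N in h *; move=> S0.
  have -> : 4 * (c * c) + n * (c * (c * N)) = c ^+ 2 * S by rewrite /S; ring.
  (* This square gives [(2 c t - c^2 S) S <= t^2 <= M S], and [S > 0] cancels. *)
  have : 0 <= (t - c * S) ^+ 2 by exact: sqr_ge0.
  move=> sq; rewrite -(ler_pM2r S0); nra.
exists (4 * z.1), (n *: z.2); split.
- by apply: (sipZ HL); exact: Lz.
- move=> h Kh; have := Hz (1, h); rewrite /weighted_ip /= mulr1 => H.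
  rewrite (ipZl HL)//; last exact: KL.
  by rewrite addrC H//; split => //=; exists h => //; rewrite scale1r.
- apply: le_trans zM; rewrite /weighted_ip (ipZl HL) ?(ipZr HL)//; last exact: (sipZ HL).
  rewrite le_eqVlt; apply/orP; left; apply/eqP; field; exact: lt0r_neq0.
Qed.

End affine_majorant.

(** * Affine minimax risk and the modulus of continuity *)

Section convex_hull.
Context {R : realType} {V : lmodType R}.
Implicit Types (A F : set V).

Definition convex_closed A : Prop :=
  forall (t : R) f g, 0 <= t <= 1 -> A f -> A g -> A (t *: f + (1 - t) *: g).

Lemma convex_setE A : convex_set A <-> convex_closed A.
Proof.
split=> [cA t f g /andP[t0 t1] Af Ag|cA f g t].
  have := cA f g (Itv01 t0 t1); rewrite !inE => /(_ Af Ag).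
  by [].
rewrite !inE => Af Ag; apply: cA => //.
by apply/andP; split.
Qed.

Lemma sub_convex_hull F : F `<=` convex_hull F.
Proof. exact: sub_smallest. Qed.

Lemma convex_hull_min F A : convex_closed A -> F `<=` A -> convex_hull F `<=` A.
Proof. by move=> cA FA; apply: smallest_sub => //; exact/convex_setE. Qed.

Lemma convex_hull_closed F : convex_closed (convex_hull F).
Proof.
move=> t f g t01 Ff Fg A [cA FA].
by apply: (convex_setE A).1 => //; [exact: Ff|exact: Fg].
Qed.

End convex_hull.

Section modulus_facts.
Context {R : realType} {V : lmodType R}.
Variables (nrm : V -> \bar R) (T : V -> R) (H : set V).

Lemma modulus_ge (e : R) f g : H f -> H g -> (nrm (g - f)%R <= e%:E)%E ->
  (`|T g - T f|%:E <= modulus nrm T e H)%E.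
Proof. by move=> Hf Hg fg; apply: ereal_sup_ubound; exists f, g. Qed.

Lemma modulus_le (e r : R) :
  (forall f g, H f -> H g -> (nrm (g - f)%R <= e%:E)%E -> `|T g - T f| <= r) ->
  (modulus nrm T e H <= r%:E)%E.
Proof.
move=> Hr; apply: ge_ereal_sup => _ [f [g [Hf Hg fg ->]]].
by rewrite lee_fin; exact: Hr.
Qed.

Lemma modulus_mono (e1 e2 : R) : e1 <= e2 ->
  (modulus nrm T e1 H <= modulus nrm T e2 H)%E.
Proof.
move=> e12; apply: ge_ereal_sup => _ [f [g [Hf Hg fg ->]]].
by apply: modulus_ge => //; rewrite (le_trans fg)// lee_fin.
Qed.

Lemma modulus_ge0 (e : R) f : H f -> (nrm 0%R <= e%:E)%E ->
  (0 <= modulus nrm T e H)%E.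
Proof.
move=> Hf n0; apply: (@le_trans _ _ (`|T f - T f|%:E)%E).
  by rewrite lee_fin.
by apply: modulus_ge => //; rewrite subrr.
Qed.

End modulus_facts.

Lemma lee_sqr_mul {R : realType} (x : \bar R) (r c : R) :
  0 <= c -> (0 <= x)%E -> (x <= r%:E)%E -> (x ^+ 2 * c%:E <= (r ^+ 2 * c)%:E)%E.
Proof.
move=> c0; case: x => [x| |]//; rewrite -EFin_expe -EFinM !lee_fin => x0 xr.
apply: ler_wpM2r => //; apply: lerXn2r; rewrite ?nnegrE//.
exact: le_trans xr.
Qed.

Lemma lee_mul_sqr {R : realType} (x : \bar R) (r c : R) :
  0 <= c -> 0 <= r -> (r%:E <= x)%E -> ((r ^+ 2 * c)%:E <= x ^+ 2 * c%:E)%E.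
Proof.
move=> c0 r0; case: x => [x| |]//; rewrite -?EFin_expe -?EFinM ?lee_fin => rx.
  by apply: ler_wpM2r => //; apply: lerXn2r; rewrite ?nnegrE// (le_trans r0).
have [->|cN] := eqVneq c 0; first by rewrite mulr0 mule0.
by rewrite expe2 mulyy gt0_mulye ?lte_fin ?lt_def ?cN// leey.
Qed.

(** * Minimax affine risk in an abstract model *)

Section minimax.
Context {R : realType} {V : lmodType R} {d : measure_display}
  {Omega : measurableType d}.
Variables (P : probability Omega R) (n : R) (L : set V) (ip : V -> V -> R)
  (nrm : V -> \bar R) (stat : V -> V -> {RV P >-> R} -> Prop)
  (D F : set V) (T : V -> R).
Hypotheses (n0 : 0 < n) (HL : semi_inner_product L ip) (cL : sip_complete L ip).
Hypothesis nrmE : forall f, L f -> nrm f = (Num.sqrt (ip f f))%:E.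
(** The bias-variance decomposition; the shift [c] will be [a - T f]. With [stat_ex], which provides
    the estimator of the upper bound, it is the whole probabilistic input. *)
Hypothesis stat_risk : forall f u X (c : R), L f -> L u -> stat f u X ->
  ('E_P[fun w => ((X w + c) ^+ 2)%R] = ((c + ip u f) ^+ 2 + ip u u / n)%:E)%E.
Hypothesis stat_ex : forall f u, L f -> L u -> exists X, stat f u X.
Hypotheses (lT : linear_functional_on D T) (F0 : F !=set0) (FD : F `<=` D)
  (FL : F `<=` L).

Let H := convex_hull F.
Let omega e := modulus nrm T e H.
Let c (e : R) := (4 * n)^-1 / (n^-1 + e ^+ 2 / 4).
Let S := ereal_sup [set (omega e ^+ 2 * (c e)%:E)%E | e in [set e : R | 0 < e]].
Let risk := minimax_affine_risk L stat T F.

Let den_gt0 (e : R) : 0 < 4 + n * e ^+ 2.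
Proof. by rewrite ltr_wpDr// mulr_ge0 ?sqr_ge0// ltW. Qed.

(** In this form, [S <= M] for a real [M] says that [omega e ^+ 2 <= M (4 + n e^2)] for every
    [e > 0]. *)
Let cE e : c e = (4 + n * e ^+ 2)^-1.
Proof.
have := den_gt0 e; rewrite /c => h; field.
by rewrite !gt_eqF//= mulrC mulrA [4 * _]mulrC -mulrA; lra.
Qed.

Let c_ge0 e : 0 <= c e.
Proof. by rewrite cE invr_ge0 ltW. Qed.

Let HF f : F f -> H f. Proof. exact: sub_convex_hull. Qed.

Let HD : H `<=` D.
Proof.
apply: convex_hull_min FD => t f g _ Df Dg; case: lT => D0 DP _.
by apply: (DP) => //; rewrite -[_ *: g]addr0; exact: DP.
Qed.

Let HsubL : H `<=` L.
Proof.
apply: convex_hull_min FL => t f g _ Lf Lg.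
by apply: (sipP HL) => //; exact: (sipZ HL).
Qed.

Let nrm0 (e : R) : 0 <= e -> (nrm 0%R <= e%:E)%E.
Proof.
move=> e0; rewrite nrmE; last exact: (sip0 HL).
by rewrite (ip0l HL) ?sqrtr0 ?lee_fin//; exact: (sip0 HL).
Qed.

Let omega_ge0 e : 0 <= e -> (0 <= omega e)%E.
Proof.
move=> e0; have [f Ff] := F0.
by apply: (@modulus_ge0 _ _ _ _ _ _ f); [exact: HF|exact: nrm0].
Qed.

(** An estimator is tied to its weight only almost surely and only for parameters in [F], which is
    all that the expectations under the supremum see. *)
Let max_risk_estimator (That : V -> {RV P >-> R}) a u : L u ->
  (forall f, F f -> exists2 X : {RV P >-> R}, stat f u X &
      {ae P, forall w, That f w = a + X w}) ->
  max_risk T F That =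
  ereal_sup [set ((a + ip u f - T f) ^+ 2 + ip u u / n)%:E | f in F].
Proof.
move=> Lu HT; rewrite /max_risk; congr ereal_sup.
apply: eq_imagel => f Ff; have [X sX TX] := HT f Ff.
have -> : (a + ip u f - T f) ^+ 2 = ((a - T f) + ip u f) ^+ 2 by ring.
rewrite -(stat_risk _ (FL Ff) Lu sX) unlock.
apply: ae_eq_integral => //.
- apply/measurable_EFinP; apply: measurable_funX.
  by apply: measurable_funB => //; exact: measurable_cst.
- apply/measurable_EFinP; apply: measurable_funX.
  by apply: measurable_funD => //; exact: measurable_cst.
- apply: filterS TX => w -> _; congr EFin; congr (_ ^+ 2); ring.
Qed.

Let lower : (S <= risk)%E.
Proof.
apply: ge_ereal_sup => _ [e /= e0 <-].
apply: le_ereal_inf_tmp => _ [That [a [u [Lu HT]]] <-].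
rewrite (max_risk_estimator Lu HT).
set r := fun f => (a + ip u f - T f) ^+ 2 + ip u u / n.
have [f0 Ff0] := F0.
have : ((r f0)%:E <= ereal_sup [set (r f)%:E | f in F])%E.
  by apply: ereal_sup_ubound; exists f0.
have : forall f, F f -> ((r f)%:E <= ereal_sup [set (r f)%:E | f in F])%E.
  by move=> f Ff; apply: ereal_sup_ubound; exists f.
case: (ereal_sup _) => [m| |]; [|by move=> _ _; rewrite leey|by []].
move=> + _ => Hm; have {}Hm f : F f -> r f <= m by move=> /Hm; rewrite lee_fin.
have uu0 : 0 <= ip u u / n by rewrite divr_ge0 ?(sip_ge0 HL)// ltW.
(* The largest bias that a maximal risk [m] allows once the variance is subtracted. *)
pose q := Num.sqrt (m - ip u u / n).
have mq : 0 <= m - ip u u / n.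
  by rewrite subr_ge0 (le_trans _ (Hm _ Ff0))// /r lerDr sqr_ge0.
have [D0 DP TP] := lT.
have DZ t g : D g -> D (t *: g) by move=> Dg; rewrite -[_ *: g]addr0; exact: DP.
have T0 : T 0 = 0 by have := TP 1 0 0 D0 D0; rewrite scale1r addr0 mul1r; lra.
have TZ t f : D f -> T (t *: f) = t * T f.
  by move=> Df; rewrite -[_ *: _]addr0 TP// T0 addr0.
(* Membership in [D] and [L] is carried along because [T] and [ip u] are linear only there. *)
pose A := [set f | [/\ D f, L f & `|a + ip u f - T f| <= q]].
have HA : H `<=` A.
  apply: convex_hull_min; last first.
    move=> f Ff; split; [exact: FD|exact: FL|].
    by rewrite -sqrtr_sqr; apply: ler_wsqrtr; rewrite lerBrDr; exact: Hm.
  move=> t f g /andP[t0 t1] [Df Lf qf] [Dg Lg qg].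
  have Dtg := DZ (1 - t) _ Dg; have Ltg := sipZ HL (1 - t) Lg.
  have Ltf := sipZ HL t Lf.
  split; [exact: DP|exact: (sipP HL)|].
  rewrite TP// TZ// (ipDr HL)// !(ipZr HL)//.
  have -> : a + (t * ip u f + (1 - t) * ip u g) - (t * T f + (1 - t) * T g)
    = t * (a + ip u f - T f) + (1 - t) * (a + ip u g - T g) by ring.
  have -> : q = t * q + (1 - t) * q by ring.
  have u0 : 0 <= 1 - t by rewrite subr_ge0.
  rewrite (le_trans (ler_normD _ _))// !normrM (ger0_norm t0) (ger0_norm u0).
  by apply: lerD; exact: ler_wpM2l.
have m0 : 0 <= m by rewrite (le_trans uu0)// -subr_ge0.
have key : (omega e <= (Num.sqrt (m * (4 + n * e ^+ 2)))%:E)%E.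
  apply: modulus_le => f g Hf Hg.
  have [Df Lf qf] := HA _ Hf; have [Dg Lg qg] := HA _ Hg.
  have Lgf := sipB HL Lg Lf.
  rewrite nrmE// lee_fin => gfe.
  rewrite -[X in X <= _]sqrtr_sqr; apply: ler_wsqrtr.
  have h1 : `|T g - T f| <= 2 * q + Num.sqrt (ip u u) * e.
    have -> : T g - T f = (a + ip u f - T f) - (a + ip u g - T g) + ip u (g - f).
      by rewrite (ipBr HL)//; ring.
    rewrite (le_trans (ler_normD _ _))// lerD//.
      by rewrite (le_trans (ler_normB _ _))//; lra.
    by rewrite (le_trans (cauchy_schwarz_sqrt HL Lu Lgf))// ler_wpM2l// sqrtr_ge0.
  have q2 : q ^+ 2 = m - ip u u / n by rewrite sqr_sqrtr.
  have s2 : Num.sqrt (ip u u) ^+ 2 = ip u u by rewrite sqr_sqrtr// (sip_ge0 HL).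
  have sq0 := sqrtr_ge0 (ip u u).
  move: (Num.sqrt (ip u u)) s2 h1 sq0 => s s2 h1 s0.
  have mE : m = q ^+ 2 + s ^+ 2 / n by rewrite q2 s2; ring.
  apply: (@le_trans _ _ ((2 * q + s * e) ^+ 2)).
    rewrite -real_normK ?num_real//; apply: lerXn2r; rewrite ?nnegrE//.
    by rewrite (le_trans _ h1).
  rewrite mE -subr_ge0.
  (* Lagrange's identity for the plane vectors [(q, s / sqrt n)] and [(2, sqrt n e)]. *)
  have -> : (q ^+ 2 + s ^+ 2 / n) * (4 + n * e ^+ 2) - (2 * q + s * e) ^+ 2
     = (n * q * e - 2 * s) ^+ 2 / n by field; exact: lt0r_neq0.
  by rewrite divr_ge0 ?sqr_ge0// ltW.
apply: le_trans (lee_sqr_mul (c_ge0 e) (omega_ge0 (ltW e0)) key) _.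
rewrite lee_fin sqr_sqrtr; last by rewrite mulr_ge0// ltW.
by rewrite cE mulfK// gt_eqF.
Qed.

Let upper : (risk <= S)%E.
Proof.
have [f0 Ff0] := F0.
have S1 e : 0 < e -> (omega e ^+ 2 * (c e)%:E <= S)%E.
  by move=> e0; apply: ereal_sup_ubound; exists e.
have : (0 <= S)%E.
  apply: le_trans (S1 _ ltr01); apply: mule_ge0; last by rewrite lee_fin.
  by rewrite expe_ge0// omega_ge0.
case SE : S => [M| |] => [|_|]; [|by rewrite leey|by []].
rewrite lee_fin => M0.
have lin := lT; case: (lT) => D0 DP TP.
have TB f g : D f -> D g -> T (f - g) = T f - T g.
  by move=> Df Dg; rewrite addrC -scaleN1r TP// mulN1r addrC.
have DB f g : D f -> D g -> D (f - g).
  by move=> Df Dg; rewrite addrC -scaleN1r; exact: DP.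
pose K : set V := [set h | exists f g, [/\ H f, H g & h = g - f]].
have KL : K `<=` L by move=> _ [f [g [Hf Hg ->]]]; apply: (sipB HL); exact: HsubL.
have KD : K `<=` D by move=> _ [f [g [Hf Hg ->]]]; apply: DB; exact: HD.
have [|||Delta [u [Lu Hu uM]]] := affine_majorant (M := M) HL n0 cL lin _ KL KD.
- by exists (f0 - f0); exists f0, f0; split => //; exact: HF.
- move=> t _ _ t01 [f [g [Hf Hg ->]]] [f' [g' [Hf' Hg' ->]]].
  exists (t *: f + (1 - t) *: f'), (t *: g + (1 - t) *: g'); split.
  + exact: convex_hull_closed.
  + exact: convex_hull_closed.
  + by rewrite !scalerBr opprD addrACA.
- move=> _ [f [g [Hf Hg ->]]].
  have Lgf := sipB HL (HsubL Hg) (HsubL Hf).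
  have ipgf := sip_ge0 HL (g - f).
  set nu := ip (g - f) (g - f) in ipgf *.
  have main (e : R) : 0 < e -> Num.sqrt nu <= e ->
      T (g - f) ^+ 2 <= M * (4 + n * e ^+ 2).
    move=> e0 nue; rewrite TB; [|exact: HD|exact: HD].
    have nE : (nrm (g - f)%R <= e%:E)%E by rewrite nrmE// lee_fin.
    have h := lee_mul_sqr (c_ge0 e) (normr_ge0 _) (modulus_ge T Hf Hg nE).
    have := le_trans h (S1 e e0); rewrite SE lee_fin cE real_normK ?num_real//.
    by rewrite ler_pdivrMr.
  (* The supremum runs over [e > 0] only and [|g - f|] may vanish, so the norm is approached from
     above. *)
  have : M * (4 + n * (Num.sqrt nu + k.+1%:R^-1) ^+ 2) @[k --> \oo]
      --> M * (4 + n * (Num.sqrt nu + 0) ^+ 2).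
    have h : Num.sqrt nu + k.+1%:R^-1 @[k --> \oo] --> Num.sqrt nu + 0.
      by apply: cvgD; [exact: cvg_cst|exact: cvg_harmonic].
    apply: cvgM; first exact: cvg_cst.
    apply: cvgD; first exact: cvg_cst.
    by apply: cvgM; [exact: cvg_cst|exact: cvgM].
  rewrite addr0 sqr_sqrtr// => /cvgr_to_ge; apply; apply: nearW => k.
  apply: main; last by rewrite lerDl invr_ge0.
  by rewrite ltr_wpDl ?sqrtr_ge0// invr_gt0.
have osc f g : F f -> F g -> T g - ip u g <= T f - ip u f + Delta.
  move=> Ff Fg; have [Lf Lg] := (FL Ff, FL Fg).
  have := Hu (g - f); rewrite TB; [|exact: FD|exact: FD].
  rewrite (ipBr HL)// => h; suff : K (g - f) by move=> /h; lra.
  by exists f, g; split => //; exact: HF.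
pose phi f := T f - ip u f.
have supF : has_sup (phi @` F).
  split; first by exists (phi f0); exists f0.
  by exists (phi f0 + Delta) => _ [g Fg <-]; exact: osc.
(* On [F] the values of [phi] lie between [sup - Delta] and [sup]; [a] is the midpoint. *)
pose a := sup (phi @` F) - Delta / 2.
have Ha f : F f -> (a + ip u f - T f) ^+ 2 <= Delta ^+ 2 / 4.
  move=> Ff.
  have h1 : phi f <= sup (phi @` F) by apply: ub_le_sup; [exact: supF.2|exists f].
  have h2 : sup (phi @` F) <= phi f + Delta.
    by apply: ge_sup; [exact: supF.1|move=> _ [g Fg <-]; exact: osc].
  rewrite /phi in h1 h2; rewrite /a /phi.
  move: (sup _) h1 h2 => s h1 h2; nra.
(* Totalized so that [choice] applies; off [F] any random variable will do. *)
have stat_f f : exists X, F f -> stat f u X.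
  have [Ff|nFf] := pselect (F f); last by exists (cst 0).
  by have [X sX] := stat_ex (FL Ff) Lu; exists X.
have [X HX] := choice stat_f.
pose That f : {RV P >-> R} := (cst a \+ X f : {mfun Omega >-> R}).
have HT f : F f -> exists2 X : {RV P >-> R}, stat f u X &
      {ae P, forall w, That f w = a + X w}.
  by move=> Ff; exists (X f); [exact: HX|exact: nearW].
apply: (@le_trans _ _ (max_risk T F That)).
  by apply: ereal_inf_lbound; exists That => //; exists a, u.
rewrite (max_risk_estimator Lu HT); apply: ge_ereal_sup => _ [f Ff <-].
by rewrite lee_fin (le_trans _ uM)// lerD2r Ha.
Qed.

Lemma minimax_affine_riskE : risk = S.
Proof. by apply/eqP; rewrite eq_le upper lower. Qed.

Let e0 : R := 2 / Num.sqrt n.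
Let e0_gt0 : 0 < e0. Proof. by rewrite divr_gt0// sqrtr_gt0. Qed.
Let ne0 : n * e0 ^+ 2 = 4.
Proof.
rewrite /e0 expr_div_n sqr_sqrtr ?ltW//; field; exact: lt0r_neq0.
Qed.

Lemma minimax_affine_risk_lower : ((8^-1)%:E * omega e0 ^+ 2 <= risk)%E.
Proof.
rewrite minimax_affine_riskE; apply: ereal_sup_ubound; exists e0 => //=.
rewrite [RHS]muleC cE ne0; congr (_ * _%:E)%E; congr (_^-1); ring.
Qed.

Lemma minimax_affine_risk_upper : (risk <= (4^-1)%:E * omega e0 ^+ 2)%E.
Proof.
rewrite minimax_affine_riskE; apply: ge_ereal_sup => _ [e /= e_gt0 <-].
rewrite [leRHS]muleC.
have := omega_ge0 (ltW e0_gt0); case wE : (omega e0) => [w| |] // => [w0|_]; last first.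
  by rewrite mulyy gt0_mulye ?lte_fin// leey.
rewrite lee_fin in w0.
(* Up to [e0], monotonicity of [omega] and [c e <= 1 / 4] suffice. *)
have [ee0|e0e] := leP e e0.
  apply: le_trans (@lee_sqr_mul _ _ w _ (c_ge0 e) (omega_ge0 (ltW e_gt0)) _) _.
    by rewrite -wE; exact: modulus_mono.
  rewrite lee_fin ler_wpM2l ?sqr_ge0// cE lef_pV2 ?posrE//.
  by rewrite lerDl mulr_ge0 ?sqr_ge0// ltW.
have scal : (omega e <= (e / e0 * w)%:E)%E.
  apply: modulus_le => f g Hf Hg.
  have [Lf Lg] := (HsubL Hf, HsubL Hg); have [Df Dg] := (HD Hf, HD Hg).
  have Lgf := sipB HL Lg Lf.
  rewrite nrmE// lee_fin => gfe.
  (* The homothety of centre [f] and ratio [t] keeps [g] in [H], brings it within [e0] of [f] and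
     multiplies the increment of [T] by [t]. *)
  pose t := e0 / e.
  have t0 : 0 <= t by rewrite divr_ge0// ltW.
  have t01 : 0 <= t <= 1 by rewrite t0/= /t ler_pdivrMr// mul1r ltW.
  have Hg' : H (t *: g + (1 - t) *: f) by exact: convex_hull_closed.
  have E : t *: g + (1 - t) *: f - f = t *: (g - f).
    by rewrite scalerBl scale1r scalerBr addrA addrAC addrK.
  have := @modulus_ge _ _ nrm T H e0 f _ Hf Hg'.
  have [D0 DP TP] := lT.
  have T0 : T 0 = 0 by have := TP 1 0 0 D0 D0; rewrite scale1r addr0 mul1r; lra.
  have Dtf : D ((1 - t) *: f) by rewrite -[_ *: f]addr0; exact: DP.
  have TZ : T ((1 - t) *: f) = (1 - t) * T f by rewrite -[_ *: f]addr0 TP// T0 addr0.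
  rewrite E nrmE; last exact: (sipZ HL).
  rewrite TP// TZ (ipZl HL) ?(ipZr HL)//; last exact: (sipZ HL).
  have -> : t * T g + (1 - t) * T f - T f = t * (T g - T f) by ring.
  rewrite mulrA sqrtrM ?sqr_ge0// -expr2 sqrtr_sqr ger0_norm//.
  rewrite -/(omega e0) wE normrM (ger0_norm t0) !lee_fin => h.
  have : t * Num.sqrt (ip (g - f) (g - f)) <= e0.
    apply: (@le_trans _ _ (t * e)); first exact: ler_wpM2l.
    by rewrite /t divfK// gt_eqF.
  move=> /h; rewrite -ler_pdivlMl; last by rewrite /t divr_gt0.
  by rewrite invf_div.
apply: le_trans (lee_sqr_mul (c_ge0 e) (omega_ge0 (ltW e_gt0)) scal) _.
rewrite lee_fin exprMn expr_div_n cE ler_pdivrMr//.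
(* The factor of [w^2] becomes [(n e^2 / 4) / (4 + n e^2)], which is below 1/4. *)
have -> : e ^+ 2 / e0 ^+ 2 = n * e ^+ 2 / 4.
  by rewrite -ne0; field; rewrite !gt_eqF.
have : 0 <= w ^+ 2 by exact: sqr_ge0.
have : 0 <= n * e ^+ 2 by rewrite mulr_ge0 ?sqr_ge0// ltW.
rewrite -[w * w]expr2; move: (n * _) (w ^+ 2) => x y x0 y0; lra.
Qed.

End minimax.

(** * Square integrable functions *)

Section square_integrable.
Context {R : realType} {d : measure_display} {T : measurableType d}.
Variables (mu : {measure set T -> \bar R}) (D : set T).
Hypothesis mD : measurable D.
Implicit Types f g h : T -> R^o.

(** Measurability of [f] is a separate clause, as that of its square does not imply it. *)
Definition sq_integrable : set (T -> R^o) := [set f |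
  measurable_fun D (f : T -> R) /\
  mu.-integrable D (EFin \o (fun x => (f x : R) ^+ 2))].

Definition ipL2 f g : R := (\int[mu]_(x in D) ((f x : R) * g x))%R.

Lemma sq_integrableM f g : sq_integrable f -> sq_integrable g ->
  mu.-integrable D (EFin \o (fun x => (f x : R) * g x)).
Proof.
move=> [mf i_f] [mg ig]; apply: (le_integrable mD _ _ (integrableD mD i_f ig)).
  by apply/measurable_EFinP; exact: measurable_funM.
move=> x _ /=; rewrite lee_fin [leRHS]ger0_norm ?addr_ge0 ?sqr_ge0//.
rewrite ler_norml; have := sqr_ge0 ((f x : R) - g x).
have := sqr_ge0 ((f x : R) + g x); have := sqr_ge0 (f x : R).
have := sqr_ge0 (g x : R); move: (f x : R) (g x : R) => a b *.
by apply/andP; split; nra.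
Qed.

Lemma sq_integrable0 : sq_integrable 0.
Proof.
split; first exact: measurable_cst.
apply: (eq_integrable mD (cst 0%E)); last exact: integrable0.
by move=> x _ /=; rewrite expr0n.
Qed.

Lemma sq_integrableDZ a f g :
  sq_integrable f -> sq_integrable g -> sq_integrable (a *: f + g).
Proof.
move=> sf sg; have [mf i_f] := sf; have [mg ig] := sg.
split.
  by apply: measurable_funD => //; apply: measurable_funM => //; exact: measurable_cst.
have i1 := integrableD mD (integrableZl mD (a ^+ 2) i_f)
  (integrableD mD (integrableZl mD (2 * a) (sq_integrableM sf sg)) ig).
apply: eq_integrable i1 => // x _ /=; rewrite -!EFinM -!EFinD; congr EFin.
rewrite (_ : (a *: f + g) x = a * (f x : R) + (g x : R))//; ring.
Qed.

Lemma sip_L2 : semi_inner_product sq_integrable ipL2.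
Proof.
split.
- exact: sq_integrable0.
- exact: sq_integrableDZ.
- by move=> f g; apply: eq_Rintegral => x _; rewrite mulrC.
- move=> a f g h sf sg sh; rewrite /ipL2.
  rewrite -RintegralZl//; last exact: sq_integrableM.
  rewrite -RintegralD//; last 2 first.
  + exact: (integrableZl mD a (sq_integrableM sf sh)).
  + exact: sq_integrableM.
  apply: eq_Rintegral => x _ /=.
  rewrite (_ : (a *: f + g) x = a * (f x : R) + (g x : R))//; ring.
- by move=> f; apply: Rintegral_ge0 => x _; exact: sqr_ge0.
Qed.

Lemma ipL2E f : sq_integrable f ->
  (\int[mu]_(x in D) ((f x : R) ^+ 2)%:E)%E = (ipL2 f f)%:E.
Proof.
by move=> [mf i_f]; rewrite /ipL2 /Rintegral fineK//; exact: integrable_fin_num.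
Qed.

Lemma sq_integrable_le f (c : R) : measurable_fun D (f : T -> R) ->
  (\int[mu]_(x in D) ((f x : R) ^+ 2)%:E <= c%:E)%E ->
  sq_integrable f /\ ipL2 f f <= c.
Proof.
move=> mf fc.
have sf : sq_integrable f.
  split => //; apply/integrableP; split.
    by apply/measurable_EFinP; exact: measurable_funX.
  under eq_integral do rewrite /= ger0_norm ?sqr_ge0//.
  exact: le_lt_trans fc (ltry _).
by split => //; rewrite -lee_fin -ipL2E.
Qed.

(* [sum_j 4^j |y_(j+1) - y_j|^2] is integrable, hence finite almost everywhere,
   which makes the increments [y_(j+1) - y_j] geometrically small. *)
Lemma sq_integrable_ae_cvg (y : nat -> T -> R^o) :
  (forall j, sq_integrable (y j)) ->
  (forall j, ipL2 (y j.+1 - y j) (y j.+1 - y j) <= 1 / (2 ^ j.+1)%:R / (4 ^ j)%:R) ->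
  {ae mu, forall x, D x -> cvgn (fun j => y j x : R)}.
Proof.
move=> sy dy.
have sd j : sq_integrable (y j.+1 - y j) := sipB sip_L2 (sy _) (sy _).
pose g j x : \bar R := ((4 ^ j)%:R * ((y j.+1 x : R) - y j x) ^+ 2)%:E.
have g0 j x : (0 <= g j x)%E by rewrite lee_fin mulr_ge0// sqr_ge0.
have mg j : measurable_fun D (g j).
  apply/measurable_EFinP; apply: measurable_funM; first exact: measurable_cst.
  by apply: measurable_funX; exact: (sd j).1.
have ig : mu.-integrable D (fun x => \sum_(0 <= j <oo) g j x)%E.
  apply/integrableP; split.
    by apply: ge0_emeasurable_sum => // j x _ _; exact: g0.
  under eq_integral do rewrite gee0_abs ?nneseries_ge0//.
  rewrite integral_nneseries//.
  apply: (@le_lt_trans _ _ 1%E); last exact: ltry.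
  (* The assumed rate is such that [4^j] times it is [2^-(j+1)], of sum at most 1. *)
  apply: (@le_trans _ _ (\sum_(0 <= j <oo) (1 / (2 ^ j.+1)%:R)%:E)%E); last first.
    exact: epsilon_trick0.
  apply: lee_nneseries => [j _ _|j _]; first by apply: integral_ge0 => x _; exact: g0.
  have p4 : 0 < (4 ^ j)%:R :> R by rewrite ltr0n expn_gt0.
  rewrite /g; under eq_integral do rewrite EFinM.
  have mdj : measurable_fun D (fun x => (((y j.+1 x : R) - y j x) ^+ 2)%:E).
    by apply/measurable_EFinP; apply: measurable_funX; exact: (sd j).1.
  have dj0 x : D x -> (0 <= (((y j.+1 x : R) - y j x) ^+ 2)%:E)%E.
    by move=> _; rewrite lee_fin sqr_ge0.
  rewrite (ge0_integralZl mu mD mdj dj0); last by rewrite lee_fin ltW.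
  have -> : (\int[mu]_(x in D) (((y j.+1 x : R) - y j x) ^+ 2)%:E)%E
    = (ipL2 (y j.+1 - y j) (y j.+1 - y j))%:E by rewrite -ipL2E.
  by rewrite -EFinM lee_fin mulrC -ler_pdivlMr.
have := integrable_ae mD ig; apply: filterS => x + Dx => /(_ Dx) gx.
pose C := fine (\sum_(0 <= j <oo) g j x)%E.
have gC j : (4 ^ j)%:R * ((y j.+1 x : R) - y j x) ^+ 2 <= C.
  rewrite -lee_fin /C fineK//; apply: le_trans (nneseries_lim_ge j.+1 _); last first.
    by move=> k _ _; exact: g0.
  rewrite big_nat_recr//= leeDr//; exact: sume_ge0.
have C0 : 0 <= C by rewrite (le_trans _ (gC 0%N))// mulr_ge0// sqr_ge0.
have dC j : `|(y j.+1 x : R) - y j x| <= Num.sqrt C * 2^-1 ^+ j.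
  have p2 : 0 < 2 ^+ j :> R by exact: exprn_gt0.
  rewrite exprVn ler_pdivlMr//.
  have nn : 0 <= `|(y j.+1 x : R) - y j x| * 2 ^+ j by rewrite mulr_ge0// ltW.
  rewrite -(ger0_norm nn) -sqrtr_sqr; apply: ler_wsqrtr; apply: le_trans (gC j).
  rewrite exprMn real_normK ?num_real// mulrC natrX -exprM mulnC exprM.
  by have -> : 2 ^+ 2 = 4%:R :> R by ring.
have cs : cvgn (series (telescope (fun j => y j x : R))).
  apply: normed_cvg; apply: series_le_cvg (fun j => normr_ge0 _)
    (fun j => le_trans (normr_ge0 _) (dC j)) dC _.
  apply: is_cvg_geometric_series.
  by rewrite ger0_norm ?invr_ge0// invf_lt1// ltr1n.
have -> : (fun j => y j x : R) =
    (fun j => (y 0%N x : R) + series (telescope (fun j => y j x : R)) j).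
  by apply/funext => j; rewrite -eq_sum_telescope.
by apply: is_cvgD => //; exact: is_cvg_cst.
Qed.

(** Riesz-Fischer: a rapidly Cauchy subsequence converges almost everywhere, and Fatou's lemma turns
    this pointwise limit into a limit in norm. *)
Lemma complete_L2 : sip_complete sq_integrable ipL2.
Proof.
move=> x sx cx.
have rate0 j : 0 < 1 / (2 ^ j.+1)%:R / (4 ^ j)%:R :> R.
  by rewrite !divr_gt0// ltr0n expn_gt0.
have [N NP] := choice (fun j => cx _ (rate0 j)).
(* A nondecreasing choice of indices dominating both [N j] and [j]. *)
pose M j := (j + \sum_(i < j.+1) N i)%N.
have NM j : (N j <= M j)%N.
  by rewrite /M big_ord_recr /= addnA leq_addl.
have MS j : (M j <= M j.+1)%N.
  by rewrite /M [in leqRHS]big_ord_recr /= leq_add// leq_addr.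
pose y j := x (M j).
have sy j : sq_integrable (y j) by exact: sx.
have aey := sq_integrable_ae_cvg sy
  (fun j => NP j _ _ (leq_trans (NM j) (MS j)) (NM j)).
(* The upper limit is measurable even where the subsequence diverges; [fine] replaces infinite
   values by 0. *)
pose z : T -> R^o := fun t => fine (limn_esup (fun j => (y j t : R)%:E)).
have yz : {ae mu, forall t, D t -> (y j t : R) @[j --> \oo] --> (z t : R)}.
  apply: filterS aey => t + Dt => /(_ Dt) cy.
  have ct : (y j t : R)%:E @[j --> \oo] --> (limn (fun j => y j t : R))%:E.
    by apply: cvg_EFin => //; exact: nearW.
  by rewrite /z (cvg_limn_einf_sup ct).2.
have mz : measurable_fun D (z : T -> R).
  apply: (@measurableT_comp _ _ _ _ _ _ (@fine R)) => //.
  apply: measurable_fun_limn_esup => j.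
  by apply/measurable_EFinP; exact: (sy j).1.
have Mj j : (j <= M j)%N by exact: leq_addr.
have main (e : R) : 0 < e -> exists K, forall k, (K <= k)%N ->
    sq_integrable (x k - z) /\ ipL2 (x k - z) (x k - z) <= e.
  move=> e0; have [K HK] := cx e e0; exists K => k Kk.
  have mxz : measurable_fun D ((x k - z) : T -> R).
    by apply: measurable_funB => //; exact: (sx k).1.
  apply: sq_integrable_le => //.
  pose h j t : \bar R := (((x k t : R) - y j t) ^+ 2)%:E.
  have h0 j t : (0 <= h j t)%E by rewrite lee_fin sqr_ge0.
  have mh j : measurable_fun D (h j).
    apply/measurable_EFinP; apply: measurable_funX.
    by apply: measurable_funB; [exact: (sx k).1|exact: (sy j).1].
  have hz : {ae mu, forall t, D t -> limn_einf (h ^~ t) = (((x k - z) t : R) ^+ 2)%:E}.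
    apply: filterS yz => t + Dt => /(_ Dt) yzt.
    have : h j t @[j --> \oo] --> (((x k - z) t : R) ^+ 2)%:E.
      apply: cvg_EFin; first exact: nearW.
      rewrite !expr2; apply: cvgM; (apply: cvgB; [exact: cvg_cst|exact: yzt]).
    by move=> /cvg_limn_einf_sup[].
  have mE : measurable_fun D (fun t => (((x k - z) t : R) ^+ 2)%:E).
    by apply/measurable_EFinP; exact: measurable_funX.
  apply: (@le_trans _ _ (\int[mu]_(t in D) limn_einf (h ^~ t))%E).
    rewrite le_eqVlt; apply/orP; left; apply/eqP; apply: ae_eq_integral => //.
      apply: measurableT_comp => //; apply: measurable_fun_limn_esup => j.
      by apply: measurableT_comp => //; exact: mh.
    by apply: filterS hz => t H Dt; rewrite H.
  apply: le_trans (fatou mu mD mh (fun j t _ => h0 j t)) _.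
  rewrite limn_einf_lim; apply: lime_le; first exact: is_cvg_einfs.
  (* The infimum over the tail from [j] is at most its term of index [i], and [M i >= K] makes the
     Cauchy bound available there. *)
  apply: nearW => j; pose i := maxn j K.
  apply: (@le_trans _ _ (\int[mu]_(t in D) h i t)%E).
    by apply: ereal_inf_lbound; exists i => //=; exact: leq_maxl.
  have := HK k (M i) Kk (leq_trans (leq_maxr j K) (Mj i)).
  by rewrite -lee_fin -ipL2E//; exact: (sipB sip_L2).
have [K1 HK1] := main 1 ltr01.
have [sK _] := HK1 _ (leqnn K1).
exists z.
  have -> : z = x K1 - (x K1 - z) by rewrite opprB addrC subrK.
  exact: (sipB sip_L2).
apply/cvgrPdist_le => e e0; have [K HK] := main e e0.
exists K => // k /= Kk; rewrite sub0r normrN ger0_norm ?(sip_ge0 sip_L2)//.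
exact: (HK k Kk).2.
Qed.

Lemma Lnorm2_restrict f : measurable_fun D (f : T -> R) ->
  'N[mu]_2%:E[EFin \o (f \_ D)]%E
  = (poweR (\int[mu]_(x in D) ((f x : R) ^+ 2)%:E) 2^-1)%E.
Proof.
move=> mf; rewrite unlock /=; congr (poweR _ _); rewrite [RHS]integral_mkcond.
apply: eq_integral => x _; rewrite patchE /=.
rewrite powR_mulrn ?real_normK ?num_real//.
by rewrite patchE; case: ifP => // _; rewrite /point/= expr0n.
Qed.

Lemma Lnorm2E f : sq_integrable f ->
  'N[mu]_2%:E[EFin \o (f \_ D)]%E = (Num.sqrt (ipL2 f f))%:E.
Proof.
move=> sf; rewrite Lnorm2_restrict; last exact: sf.1.
by rewrite ipL2E// poweR_EFin powR12_sqrt// (sip_ge0 sip_L2).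
Qed.

Lemma Lfun2E f : ((f \_ D : T -> R) \in Lfun mu 2%:E) <-> sq_integrable f.
Proof.
split=> [Lf|sf].
  have mf : measurable_fun D (f : T -> R).
    move: Lf; rewrite inE => /andP[/[!inE]/= mf _].
    exact/(measurable_restrictT (f : T -> R) mD).
  split => //; apply/(integrable_mkcond _ mD).
  move: (Lfun2_integrable_sqr Lf); apply: eq_integrable => // x _.
  by rewrite /= !patchE; case: ifP => // _; rewrite /point/= expr0n.
rewrite inE; apply/andP; split; rewrite inE /=.
  by apply/(measurable_restrictT (f : T -> R) mD); exact: sf.1.
by rewrite /finite_norm Lnorm2E// ltry.
Qed.

Lemma cvg_Lnorm2 (f : nat -> T -> R^o) l :
  (forall k, sq_integrable (f k)) -> sq_integrable l ->
  ('N[mu]_2%:E[EFin \o ((l - f k)%R \_ D)]%E @[k --> \oo] --> 0%E) <->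
  sip_cvg ipL2 f l.
Proof.
move=> sf sl.
have slf k := sipB sip_L2 sl (sf k).
have E k : ipL2 (f k - l) (f k - l) = ipL2 (l - f k) (l - f k).
  by rewrite !(ip_sqrB sip_L2)// (sipC sip_L2 l); ring.
under eq_fun do rewrite Lnorm2E//.
rewrite /sip_cvg; under [X in _ <-> X @ _ --> _]eq_fun do rewrite E.
split=> [/fine_cvgP[_] h|h].
  rewrite -(mulr0 0); apply: cvg_trans (cvgM h h); apply: near_eq_cvg.
  by apply: nearW => k; rewrite /= -expr2 sqr_sqrtr// (sip_ge0 sip_L2).
apply: cvg_EFin; first exact: nearW.
rewrite -(sqrtr0 R); apply: continuous_cvg => //; exact: sqrt_continuous.
Qed.

End square_integrable.

(** * Mean-square limits of linear statistics *)

Section mean_square.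
Context {R : realType} {d : measure_display} {Omega : measurableType d}.
Variable P : probability Omega R.
Implicit Types (Z X : Omega -> R^o).

Local Notation L2P := (sq_integrable P [set: Omega]).
Local Notation ipP := (ipL2 P [set: Omega]).
Let mT : measurable [set: Omega] := measurableT.
Let HP : semi_inner_product L2P ipP := sip_L2 P mT.

Lemma sq_integrable_cst (c : R) : L2P (cst c).
Proof.
split; first exact: measurable_cst.
exact: (finite_measure_integrable_cst P (c ^+ 2)).
Qed.

Lemma ipP_cst : ipP (cst 1) (cst 1) = 1.
Proof.
apply: EFin_inj; rewrite -(ipL2E mT (sq_integrable_cst 1)) /=.
under eq_integral do rewrite expr1n.
by rewrite integral_cst// mul1e; exact: probability_setT.
Qed.

Lemma expectation_sqr X : L2P X -> ('E_P[fun w => (X w ^+ 2)%R])%E = (ipP X X)%:E.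
Proof. by move=> sX; rewrite unlock ipL2E. Qed.

(** Square integrability of the limit is part of the conclusion: for some [k] the expectation of
    [(Z k - X)^2] is finite, and [X = Z k - (Z k - X)]. *)
Lemma mean_square_cvgP (Z : nat -> Omega -> R^o) (X : {RV P >-> R}) :
  (forall k, L2P (Z k)) ->
  mean_square_cvg P Z X <-> L2P X /\ sip_cvg ipP Z X.
Proof.
move=> sZ.
have E k : L2P X -> ('E_P[fun w => ((Z k w - X w) ^+ 2)%R])%E
    = (ipP (Z k - (X : Omega -> R^o)) (Z k - (X : Omega -> R^o)))%:E.
  by move=> sX; rewrite unlock -ipL2E//; exact: (sipB HP).
split=> [ZX|[sX ZX]].
  have mZX k : measurable_fun setT ((Z k - (X : Omega -> R^o)) : Omega -> R).
    by apply: measurable_funB => //; exact: (sZ k).1.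
  have sX : L2P X.
    have /fine_cvgP[[N _ HN] /cvgrPdist_le/(_ 1 ltr01)[M _ HM]] := ZX.
    pose k := maxn N M.
    have := HN k (leq_maxl _ _); have := HM k (leq_maxr _ _) => /=.
    rewrite sub0r normrN => h1 h2.
    have sZX : L2P (Z k - (X : Omega -> R^o)).
      apply: (@sq_integrable_le _ _ _ P setT mT _ 1 (mZX k) _).1.
      have -> : (\int[P]_x (((Z k - (X : Omega -> R^o)) x : R) ^+ 2)%:E)%E
          = ('E_P[fun w => ((Z k w - X w) ^+ 2)%R])%E by rewrite unlock.
      by rewrite -(fineK h2) lee_fin (le_trans _ h1)// ler_norm.
    have -> : (X : Omega -> R^o) = Z k - (Z k - (X : Omega -> R^o)).
      by rewrite opprB addrC subrK.
    exact: (sipB HP).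
  split => //; rewrite /sip_cvg.
  move: ZX; rewrite /mean_square_cvg => /fine_cvgP[_].
  apply: cvg_trans; apply: near_eq_cvg; apply: nearW => k /=.
  by rewrite E.
rewrite /mean_square_cvg; under eq_fun do rewrite E//.
by apply: cvg_EFin => //; exact: nearW.
Qed.

Section isometry.
Context {V : lmodType R}.
Variables (L : set V) (ip : V -> V -> R) (n : R).
Variables (f u : V) (v : nat -> V) (Z : nat -> Omega -> R^o).
Hypotheses (HL : semi_inner_product L ip) (n0 : 0 < n).
Hypotheses (Lf : L f) (Lu : L u) (Lv : forall k, L (v k)) (sZ : forall k, L2P (Z k)).
(** In both models [Z k] is the statistic with elementary weight [v k], a step function or a finite
    sequence: its mean is [<f, v k>] and the noise contributes the covariance [<v k, v l> / n]. *)
Hypothesis meanZ : forall k, ipP (Z k) (cst 1) = ip f (v k).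
Hypothesis covZ : forall k l,
  ipP (Z k) (Z l) = ip f (v k) * ip f (v l) + ip (v k) (v l) / n.
Hypothesis vu : sip_cvg ip v u.

(** [E (Z k - Z l)^2 = <f, v k - v l>^2 + |v k - v l|^2 / n <= (|f|^2 + 1 / n) |v k - v l|^2], so
    [Z] inherits the Cauchy property of [v]. *)
Lemma mean_square_limit_ex : exists X : {RV P >-> R}, mean_square_cvg P Z X.
Proof.
suff cZ : sip_cauchy ipP Z.
  have [X sX ZX] := complete_L2 mT sZ cZ.
  pose X' : {RV P >-> R} :=
    mfun_Sub (mem_set (sX.1 : measurable_fun setT (X : Omega -> R))).
  by exists X'; apply/(mean_square_cvgP X' sZ).
move=> e e0; pose B := ip f f + n^-1.
have B0 : 0 < B by rewrite ltr_wpDl ?(sip_ge0 HL)// invr_gt0.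
have [N HN] := sip_cvg_cauchy HL Lv Lu vu (divr_gt0 e0 B0).
exists N => k l Nk Nl; have := HN k l Nk Nl; rewrite ler_pdivlMr//.
apply: le_trans; rewrite mulrC /B mulrDl.
have Lkl := sipB HL (Lv k) (Lv l).
rewrite (ip_sqrB HP)// !covZ.
have -> : ip f (v k) * ip f (v k) + ip (v k) (v k) / n -
    2 * (ip f (v k) * ip f (v l) + ip (v k) (v l) / n) +
    (ip f (v l) * ip f (v l) + ip (v l) (v l) / n) =
  ip f (v k - v l) ^+ 2 + n^-1 * ip (v k - v l) (v k - v l).
  by rewrite (ip_sqrB HL)// (ipBr HL)//; ring.
by rewrite lerD2r (cauchy_schwarz HL).
Qed.

(** First and second moments pass to mean-square limits. The result depends on [v] only through its
    limit [u], so every version of the statistic has the same risk. *)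
Lemma mean_square_limit_risk (X : {RV P >-> R}) (c : R) : mean_square_cvg P Z X ->
  ('E_P[fun w => ((X w + c) ^+ 2)%R] = ((c + ip u f) ^+ 2 + ip u u / n)%:E)%E.
Proof.
move=> /(mean_square_cvgP X sZ)[sX ZX].
have s1 := sq_integrable_cst 1.
have Lfu : ip f (v k) @[k --> \oo] --> ip f u.
  exact: (sip_cvg_ip HL (fun=> Lf) Lv Lf Lu (sip_cvg_cst HL Lf) vu).
have eX : ipP X (cst 1) = ip f u.
  have h : ipP (Z k) (cst 1) @[k --> \oo] --> ip f u.
    by under eq_fun do rewrite meanZ.
  exact: (cvg_unique _ (sip_cvg_ip HP sZ (fun=> s1) sX s1 ZX (sip_cvg_cst HP s1)) h).
have eXX : ipP X X = ip f u ^+ 2 + ip u u / n.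
  have h : ipP (Z k) (Z k) @[k --> \oo] --> ip f u ^+ 2 + ip u u / n; last first.
    exact: (cvg_unique _ (sip_cvg_ip HP sZ sZ sX sX ZX ZX) h).
  under eq_fun do rewrite covZ.
  apply: cvgD; first by rewrite expr2; exact: cvgM.
  apply: cvgM; last exact: cvg_cst.
  exact: (sip_cvg_ip HL Lv Lv Lu Lu vu vu).
have sc := sipZ HP c s1.
have -> : (fun w => (X w + c) ^+ 2) =
    (fun w => (((X : Omega -> R^o) + c *: (cst 1 : Omega -> R^o)) w : R) ^+ 2).
  by apply/funext => w; rewrite -[c in LHS]mulr1.
rewrite expectation_sqr; last exact: (sipD HP).
rewrite (ip_sqrD HP)// (ipZl HP)// !(ipZr HP)// ipP_cst eX eXX (sipC HL u f).
by congr EFin; ring.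
Qed.

End isometry.
End mean_square.

(** * Normal random variables *)

Section normal_moments.
Context {R : realType}.
Variable (s : R).
Hypothesis s0 : 0 < s.
Local Notation mu := (@lebesgue_measure R).
Local Notation p := (normal_pdf 0 s).

Let sN0 : s != 0. Proof. exact: lt0r_neq0. Qed.

Lemma centered_normal_pdfE x :
  p x = normal_peak s * expR (- x ^+ 2 / (s ^+ 2 *+ 2)).
Proof. by rewrite normal_pdfE// /normal_fun subr0. Qed.

Lemma centered_normal_pdfN x : p (- x) = p x.
Proof. by rewrite !centered_normal_pdfE sqrrN. Qed.

Lemma is_derive_normal_pdf (x : R) : is_derive x 1 p (- x / s ^+ 2 * p x).
Proof.
pose c : R := s ^+ 2 *+ 2.
have -> : p = normal_peak s \*: (expR \o ((- c^-1) \*: (@id R ^+ 2))) :> (R -> R).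
  apply/funext => y; rewrite centered_normal_pdfE /=.
  rewrite [X in _ = X](_ : _ = normal_peak s * expR (- c^-1 * y ^+ 2))//.
  by congr (_ * expR _); rewrite /c !mulNr [y ^+ 2 / _]mulrC.
apply: is_derive_eq.
rewrite /GRing.scale /=; move: (expR _) => E.
rewrite (_ : normal_peak s *: E = normal_peak s * E)// expr1 mulr1 /c.
by field.
Qed.

(** The boundary term of an integration by parts. The bound [expR y >= 1 + y] gives decay of order
    [1 / k]; the factor 4 leaves room for [k (k + 1) <= 4 s^2 + 2 k^2]. *)
Lemma cvg_mul_normal_pdf : k%:R * p k%:R @[k --> \oo] --> (0 : R).
Proof.
have c0 := normal_peak_ge0 s.
have b0 k : 0 <= k%:R * p k%:R by rewrite mulr_ge0// normal_pdf_ge0.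
have s20 : 0 < s ^+ 2 by exact: exprn_gt0.
have bk k : k%:R * p k%:R <= 4 * normal_peak s * s ^+ 2 * k.+1%:R^-1.
  rewrite centered_normal_pdfE.
  set y := k%:R ^+ 2 / (s ^+ 2 *+ 2).
  have y0 : 0 <= y by rewrite divr_ge0 ?sqr_ge0// mulrn_wge0// sqr_ge0.
  have ey : expR (- k%:R ^+ 2 / (s ^+ 2 *+ 2)) <= (1 + y)^-1.
    rewrite mulNr -/y expRN lef_pV2 ?posrE ?expR_gt0 ?expR_ge1Dx//.
    by rewrite ltr_wpDr.
  have -> : 4 * normal_peak s * s ^+ 2 * k.+1%:R^-1
    = normal_peak s * (4 * s ^+ 2 * k.+1%:R^-1) by ring.
  rewrite mulrCA; apply: ler_wpM2l => //.
  apply: le_trans (ler_wpM2l (ler0n _ k) ey) _.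
  rewrite ler_pdivrMr ?ltr_wpDr// mulrAC ler_pdivlMr ?ltr0n//.
  have -> : 4 * s ^+ 2 * (1 + y) = 4 * s ^+ 2 + 2 * k%:R ^+ 2.
    by rewrite /y; field.
  rewrite -natr1; case: k {y y0 ey} => [|k]; first by nra.
  have : 1 <= k.+1%:R :> R by rewrite ler1n.
  by move: (k.+1%:R) => x x1; nra.
have h : 4 * normal_peak s * s ^+ 2 * k.+1%:R^-1 @[k --> \oo] --> (0 : R).
  rewrite -[X in _ --> X](mulr0 (4 * normal_peak s * s ^+ 2)).
  by apply: cvgM; [exact: cvg_cst|exact: cvg_harmonic].
apply: (squeeze_cvgr _ (cvg_cst 0) h); apply: nearW => k.
by rewrite b0 bk.
Qed.

Let measurable_p : measurable_fun setT p. Proof. exact: measurable_normal_pdf. Qed.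

Lemma integral0y_normal_pdf : (\int[mu]_(x in `[0%R, +oo[) (p x)%:E = (2^-1)%:E)%E.
Proof.
have := @ge0_symfun_integralT R p (normal_pdf_ge0 0 s)
  (@continuous_normal_pdf R 0 s sN0) (fun x => esym (centered_normal_pdfN x)).
rewrite integral_normal_pdf.
have -> : [set x : R | 0 <= x] = `[0%R, +oo[%classic by rewrite set_itvE.
have : (0 <= \int[mu]_(x in `[0%R, +oo[) (p x)%:E)%E.
  by apply: integral_ge0 => x _; rewrite lee_fin normal_pdf_ge0.
case: (\int[mu]_(x in _) _)%E => [r| |]// r0.
- rewrite -EFinM => -[h]; congr EFin.
  by rewrite -[LHS](mulKf (_ : 2 != 0)) -?h ?mulr1// pnatr_eq0.
- by rewrite gt0_muley// lte_fin.
Qed.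

(** Since [x p x] is the derivative of [- s^2 p x], parts on [[0, k]] turn [x (x p x)] into
    [s^2 p x] plus a boundary term; monotone convergence lets [k] grow. *)
Lemma integral0y_sqr_normal_pdf :
  (\int[mu]_(x in `[0%R, +oo[) (x ^+ 2 * p x)%:E = (s ^+ 2 / 2)%:E)%E.
Proof.
pose F k := `[0%R, k%:R]%classic : set R.
have UF : \bigcup_k F k = `[0%R, +oo[%classic.
  apply/seteqP; split=> [x [k _]|x]; rewrite /F /= !in_itv/= ?andbT.
    by case/andP.
  move=> x0; exists (Num.truncn x).+1 => //=; rewrite in_itv/= x0/= ltW//.
  exact: truncnS_gt.
have ndF : nondecreasing_seq F.
  move=> i j ij; rewrite subsetEset => x; rewrite /F /= !in_itv/= => /andP[-> xi]/=.
  by rewrite (le_trans xi)// ler_nat.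
have mF k : measurable (F k) by exact: measurable_itv.
have cvg2 : (\int[mu]_(x in F k) (x ^+ 2 * p x)%:E)%E @[k --> \oo] -->
    (\int[mu]_(x in `[0%R, +oo[) (x ^+ 2 * p x)%:E)%E.
  rewrite -UF; apply: ge0_nondecreasing_set_cvg_integral => //.
  - move=> k; apply/measurable_EFinP; apply: measurable_funTS.
    by apply: measurable_funM => //; exact: measurable_funX.
  - by move=> k x _; rewrite lee_fin mulr_ge0 ?sqr_ge0 ?normal_pdf_ge0.
have cvg0 : (\int[mu]_(x in F k) (p x)%:E)%E @[k --> \oo] --> (2^-1)%:E.
  rewrite -integral0y_normal_pdf -UF; apply: ge0_nondecreasing_set_cvg_integral => //.
  - by move=> k; apply/measurable_EFinP; exact: measurable_funTS.
  - by move=> k x _; rewrite lee_fin normal_pdf_ge0.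
have dp x : derivable p x 1 by have [] := is_derive_normal_pdf x.
have cp : continuous p by exact: continuous_normal_pdf.
have parts k : (0 < k)%N -> (\int[mu]_(x in F k) (x ^+ 2 * p x)%:E)%E =
   ((- s ^+ 2 * (k%:R * p k%:R))%:E + (s ^+ 2)%:E * \int[mu]_(x in F k) (p x)%:E)%E.
  move=> k0.
  have cG : continuous (fun x : R => - s ^+ 2 * p x).
    by move=> x; apply: cvgM; [exact: cvg_cst|exact: cp].
  have cg : continuous (fun x : R => x * p x).
    by move=> x; apply: cvgM; [exact: cvg_id|exact: cp].
  have dG (x : R) : is_derive x 1 (fun x : R => - s ^+ 2 * p x : R) (x * p x).
    have := is_deriveZ (- s ^+ 2) (is_derive_normal_pdf x).
    rewrite (_ : _ *: _ = x * p x)//.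
    by rewrite /GRing.scale/=; field.
  have := @integration_by_parts R id (fun x => - s ^+ 2 * p x) (fun=> 1)
    (fun x => x * p x) 0 k%:R.
  rewrite ltr0n => /(_ k0) H.
  have {H} := H _ _ _ _ _ _.
  have E0 : (\int[mu]_(x in F k) (x ^+ 2 * p x)%:E =
      \int[mu]_(x in `[0%R, k%:R]) (id x * (x * p x))%:E)%E.
    by apply: eq_integral => x _; rewrite mulrA -expr2.
  rewrite E0 => ->.
  - have -> : (\int[mu]_(x in `[0%R, k%:R]) (1 * (- s ^+ 2 * p x))%:E
       = - ((s ^+ 2)%:E * \int[mu]_(x in F k) (p x)%:E))%E.
      under eq_integral do rewrite mul1r EFinM.
      rewrite integralZl//; first by rewrite EFinN mulNe.
      by apply: integrableS (integrable_normal_pdf 0 s).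
    rewrite oppeK mul0r subr0; congr (_%:E + _)%E; ring.
  - by apply: continuous_subspaceT => x; exact: cvg_cst.
  - split; [|exact: cvg_at_right_filter|exact: cvg_at_left_filter].
    by move=> x _; exact: derivable_id.
  - by move=> x _; rewrite derive1E derive_id.
  - exact: continuous_subspaceT.
  - split; [|exact/cvg_at_right_filter/cG|exact/cvg_at_left_filter/cG].
    by move=> x _; have [] := dG x.
  - by move=> x _; rewrite derive1E; have [_ ->] := dG x.
have lim : ((- s ^+ 2 * (k%:R * p k%:R))%:E +
      (s ^+ 2)%:E * \int[mu]_(x in F k) (p x)%:E)%E
    @[k --> \oo] --> ((- s ^+ 2 * 0)%:E + (s ^+ 2)%:E * (2^-1)%:E)%E.
  apply: cvgeD => //.
  - apply: cvg_EFin; first exact: nearW.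
    by apply: cvgM; [exact: cvg_cst|exact: cvg_mul_normal_pdf].
  - exact: cvgeZl.
have -> : (s ^+ 2 / 2)%:E = ((- s ^+ 2 * 0)%:E + (s ^+ 2)%:E * (2^-1)%:E)%E.
  by rewrite -EFinM -EFinD mulr0 add0r.
apply: (cvg_unique _ cvg2) => //.
move: lim; apply: cvg_trans; apply: near_eq_cvg.
by exists 1%N => // k /= k1; rewrite parts.
Qed.

Lemma integral_sqr_normal_pdf :
  (\int[mu]_x (x ^+ 2 * p x)%:E = (s ^+ 2)%:E)%E.
Proof.
rewrite (@ge0_symfun_integralT R (fun x => x ^+ 2 * p x)).
- have -> : [set x : R | 0 <= x] = `[0%R, +oo[%classic by rewrite set_itvE.
  by rewrite integral0y_sqr_normal_pdf -EFinM; congr EFin; field.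
- by move=> x; rewrite mulr_ge0 ?sqr_ge0 ?normal_pdf_ge0.
- move=> x; apply: cvgM; first exact: exprn_continuous.
  exact: continuous_normal_pdf.
- by move=> x /=; rewrite sqrrN centered_normal_pdfN.
Qed.

(** The centering of the law, written with nonnegative integrands because the change of law below is
    stated for those. *)
Lemma integral_pos_neg_normal_pdf :
  (\int[mu]_x (Num.max x 0 * p x)%:E = \int[mu]_x (Num.max (- x) 0 * p x)%:E)%E.
Proof.
have -> : (\int[mu]_x (Num.max x 0 * p x)%:E =
    \int[mu]_(x in `[0%R, +oo[) (x * p x)%:E)%E.
  rewrite [RHS]integral_mkcond; apply: eq_integral => x _.
  rewrite patchE mem_setE in_itv/= andbT.
  by case: leP => // x0; rewrite mul0r.
have -> : (\int[mu]_x (Num.max (- x) 0 * p x)%:E =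
    \int[mu]_(x in `]-oo, (- 0)%R]) (- x * p x)%:E)%E.
  rewrite [RHS]integral_mkcond; apply: eq_integral => x _.
  rewrite patchE mem_setE in_itv/= oppr0.
  by rewrite /Num.max oppr_lt0 leNgt; case: ltP => // x0; rewrite mul0r.
rewrite (@ge0_integration_by_substitutionNy R (fun x => - x * p x)).
- by apply: eq_integral => x _ /=; rewrite opprK centered_normal_pdfN.
- apply: continuous_subspaceT => x; apply: cvgM; first by apply: cvgN; exact: cvg_id.
  exact: continuous_normal_pdf.
- move=> x; rewrite in_itv/= oppr0 => x0.
  by rewrite mulr_ge0 ?normal_pdf_ge0// oppr_ge0 ltW.
Qed.

(** The density agrees almost everywhere with the Radon-Nikodym derivative of the law, as both have
    the same integral over every measurable set. *)
Lemma ge0_integral_normal_prob (h : R -> R) : (forall x, 0 <= h x) ->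
  measurable_fun setT h ->
  (\int[normal_prob 0 s]_x (h x)%:E = \int[mu]_x (h x * p x)%:E)%E.
Proof.
move=> h0 mh; have dom := normal_prob_dominates 0 s.
have h0' x : (0 <= (h x)%:E)%E by rewrite lee_fin.
have mh' : measurable_fun setT (EFin \o h) by exact/measurable_EFinP.
rewrite -(Radon_Nikodym_SigmaFinite.change_of_variables dom h0' measurableT mh').
have RNE : ae_eq mu setT (Radon_Nikodym_SigmaFinite.f (normal_prob 0 s) mu) (EFin \o p).
  apply: integral_ae_eq => //.
  - exact: Radon_Nikodym_SigmaFinite.f_integrable.
  - exact/measurable_EFinP.
  - by move=> E _ mE; rewrite -(Radon_Nikodym_SigmaFinite.f_integral dom).
apply: ae_eq_integral => //.
- apply: emeasurable_funM; first exact/measurable_EFinP.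
  exact: measurable_int (Radon_Nikodym_SigmaFinite.f_integrable dom).
- by apply/measurable_EFinP; exact: measurable_funM.
- by apply: filterS RNE => x + _ => -> //; rewrite -EFinM.
Qed.

End normal_moments.

(** * Random variables with a centered normal law *)

Section normal_random_variable.
Context {R : realType} {d : measure_display} {Omega : measurableType d}.
Variables (P : probability Omega R) (X : {RV P >-> R}) (s : R).
Hypotheses (s0 : 0 < s)
  (PX : forall A, measurable A -> pushforward P X A = normal_prob 0 s A).

Lemma ge0_expectation_normal (h : R -> R) : (forall x, 0 <= h x) ->
  measurable_fun setT h ->
  (\int[P]_w (h (X w))%:E = \int[lebesgue_measure]_x (h x * normal_pdf 0 s x)%:E)%E.
Proof.
move=> h0 mh; rewrite -ge0_integral_normal_prob//.
rewrite -(@ge0_integral_distribution _ _ _ _ _ P X (EFin \o h))//; last first.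
  exact/measurable_EFinP.
(* [R] and the type carrying [normal_prob] have distinct measurable structures
   with the same sets. *)
pose idR : measurableTypeR R -> R := idfun.
have mid : measurable_fun setT idR by move=> ? A ?; rewrite setTI.
rewrite (eq_measure_integral (pushforward (normal_prob 0 s) idR)); last first.
  by move=> A mA _; exact: PX.
have mh' : measurable_fun setT (EFin \o h) by exact/measurable_EFinP.
rewrite (ge0_integral_pushforward mid _ measurableT mh') => [|y _]; last by rewrite lee_fin.
by rewrite preimage_setT.
Qed.

Lemma normal_sq_integrable :
  sq_integrable P setT (X : Omega -> R^o) /\ ipL2 P setT (X : Omega -> R^o) X = s ^+ 2.
Proof.
have E : (\int[P]_w ((X w) ^+ 2)%:E = (s ^+ 2)%:E)%E.
  rewrite (@ge0_expectation_normal (fun x => x ^+ 2)); last 2 first.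
  - by move=> x; exact: sqr_ge0.
  - exact: measurable_funX.
  exact: integral_sqr_normal_pdf.
have leE : (\int[P]_w ((X w) ^+ 2)%:E <= (s ^+ 2)%:E)%E by rewrite E.
have [sX _] := @sq_integrable_le _ _ _ P setT measurableT (X : Omega -> R^o) (s ^+ 2)
   (measurable_funPT X) leE.
split => //; apply: EFin_inj; rewrite -ipL2E//.
Qed.

Lemma normal_mean : ipL2 P setT (X : Omega -> R^o) (cst 1) = 0.
Proof.
rewrite /ipL2; under eq_Rintegral do rewrite mulr1.
rewrite /Rintegral integralE.
have -> : (\int[P]_w ((fun w => (X w)%:E)^\+ w) = \int[P]_w (Num.max (X w) 0)%:E)%E.
  by apply: eq_integral => w _; rewrite funeposE EFin_max.
have -> : (\int[P]_w ((fun w => (X w)%:E)^\- w) = \int[P]_w (Num.max (- X w) 0)%:E)%E.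
  by apply: eq_integral => w _; rewrite funenegE EFin_max.
have mpos : measurable_fun setT (fun x : R => Num.max x 0).
  by apply: measurable_maxr => //; exact: measurable_cst.
have mneg : measurable_fun setT (fun x : R => Num.max (- x) 0).
  by apply: measurable_maxr => //; exact: measurable_cst.
rewrite (@ge0_expectation_normal (fun x => Num.max x 0))//; last first.
  by move=> x; rewrite le_max lexx orbT.
rewrite (@ge0_expectation_normal (fun x => Num.max (- x) 0))//; last first.
  by move=> x; rewrite le_max lexx orbT.
rewrite integral_pos_neg_normal_pdf//.
(* [fine] sends infinite values to 0, so only a finite common value remains. *)
by case: (\int[_]_x _)%E => //= r; rewrite subrr.
Qed.

End normal_random_variable.

(** * White noise model *)

Section step_functions.
Context {R : realType}.
Variable I : interval R.
Local Notation mu := (@lebesgue_measure R).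
Local Notation L2I := (sq_integrable mu [set` I]).
Local Notation ipI := (ipL2 mu [set` I]).

Let mI : measurable ([set` I] : set (measurableTypeR R)).
Proof. exact: measurable_itv. Qed.
Let HI : semi_inner_product L2I ipI := sip_L2 mu mI.

Lemma subset_ocitv (s t : R) : s \in I -> t \in I -> `]s, t]%classic `<=` [set` I].
Proof.
move=> sI tI x /=; rewrite in_itv/= => /andP[sx xt].
by apply: (@interval_is_interval R I s t) => //; rewrite (ltW sx).
Qed.

(** From [|g| <= 1 + g^2] on a set of finite measure; it provides the local integrability that
    Lebesgue differentiation asks for. *)
Lemma integrable_restrict_sq_integrable (g : R -> R^o) (A : set (measurableTypeR R)) :
  L2I g -> measurable A -> (mu A < +oo)%E ->
  mu.-integrable A (EFin \o (g \_ [set` I] : R -> R)).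
Proof.
move=> sg mA Afin.
have mh := (measurable_restrictT (g : measurableTypeR R -> R) mI).1 sg.1.
have i1 : mu.-integrable A (EFin \o cst (1 : R)).
  apply/integrableP; split; first by apply/measurable_EFinP; exact: measurable_cst.
  by under eq_integral do rewrite /= normr1; rewrite integral_cst// mul1e.
have i2 : mu.-integrable A ((EFin \o (fun x => (g x : R) ^+ 2)) \_ [set` I]).
  apply: (@integrableS _ _ _ _ setT) => //; exact/(integrable_mkcond _ mI)/sg.2.
apply: (le_integrable mA _ _ (integrableD mA i1 i2)).
  by apply/measurable_EFinP; exact: measurable_funTS.
move=> x _ /=; rewrite !patchE; case: ifP => _ /=; last first.
  by rewrite lee_fin /point /= normr0 addr0 normr1.
rewrite lee_fin [leRHS]ger0_norm ?addr_ge0 ?sqr_ge0//.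
have := sqr_ge0 (`|g x : R| - 1); have := real_normK (num_real (g x : R)).
have := normr_ge0 (g x : R); move: (`|_|) => a a0 <-; nra.
Qed.

(* By Lebesgue differentiation of the vanishing primitives of [g] based at the
   rational points of [I]. *)
Lemma orthogonal_steps_ae0 (g : R -> R^o) : L2I g ->
  (forall s t, s \in I -> t \in I -> s <= t -> \int[mu]_(x in `]s, t]) (g x : R) = 0) ->
  {ae mu, forall x, x \in I -> g x = 0}.
Proof.
move=> sg orth.
pose h : R -> R := g \_ [set` I].
have mh : measurable_fun (setT : set (measurableTypeR R)) h.
  exact: (measurable_restrictT (g : measurableTypeR R -> R) mI).1 sg.1.
have finh := @integrable_restrict_sq_integrable g _ sg.
have loch : locally_integrable setT h.
  split => //; first exact: openT.
  move=> K _ cK.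
  have mK : measurable (K : set (measurableTypeR R)).
    by apply: closed_measurable; apply: compact_closed => //; exact: Rhausdorff.
  by have /integrableP[] := finh K mK (compact_finite_measure cK).
(* An enumeration of the rationals, with 0 for invalid codes; countably many base points keep the
   exceptional set null. *)
pose q k : R := ratr (odflt 0 (@unpickle rat k)).
have aeq : {ae mu, forall x, forall k, q k < x ->
    derivable (fun y => \int[mu]_(t in `]q k, y]) h t) x 1 /\
    derive1 (fun y => \int[mu]_(t in `]q k, y]) h t) x = h x}.
  apply: ae_foralln => k.
  have ih y : mu.-integrable `]q k, y] (EFin \o h).
    apply: finh; first exact: measurable_itv.
    by rewrite lebesgue_measure_itv /=; case: ifP => // _; rewrite -EFinD ltry.
  have := FTC1 ih loch; apply: (@filterS _ _ (ae_filter_ringOfSetsType mu)).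
  by move=> x H qx; apply: H; exact: qx.
(* The least and the greatest elements of [I], at most one point each; any other point of [I] has
   points of [I] on both sides. *)
pose E1 := [set x | x \in I /\ forall y, y \in I -> x <= y].
pose E2 := [set x | x \in I /\ forall y, y \in I -> y <= x].
have aeE (E : set R) : (forall x y, E x -> E y -> x = y) -> {ae mu, forall x, ~ E x}.
  move=> E1x; have [[x Ex]|nE] := pselect (exists x, E x).
    exists [set x]; split; [exact: measurable_set1|exact: lebesgue_measure_set1|].
    by move=> y /= /contrapT Ey; exact: E1x.
  by apply: nearW => x Ex; apply: nE; exists x.
have ae1 : {ae mu, forall x, ~ E1 x}.
  by apply: aeE => x y [xI Hx] [yI Hy]; apply/eqP; rewrite eq_le Hx// Hy.
have ae2 : {ae mu, forall x, ~ E2 x}.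
  by apply: aeE => x y [xI Hx] [yI Hy]; apply/eqP; rewrite eq_le Hx// Hy.
move: aeq ae1 ae2.
apply: (@filterS3 _ _ (ae_filter_ringOfSetsType mu)) => x Hx nE1 nE2 xI.
have [y1 y1I y1x] : exists2 y, y \in I & y < x.
  apply: contrapT => nex; apply: nE1; split => // y yI; rewrite leNgt; apply/negP => yx.
  by apply: nex; exists y.
have [y2 y2I xy2] : exists2 y, y \in I & x < y.
  apply: contrapT => nex; apply: nE2; split => // y yI; rewrite leNgt; apply/negP => yx.
  by apply: nex; exists y.
have [r] := rat_in_itvoo y1x; rewrite in_itv/= => /andP[y1r rx].
have qr : q (pickle r) = ratr r by rewrite /q pickleK.
have rI : ratr r \in I.
  by apply: (@interval_is_interval R I y1 x) => //; rewrite !ltW.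
have := Hx (pickle r); rewrite qr => /(_ rx)[_].
have -> : h x = g x by rewrite /h patchE mem_set.
move=> <-.
rewrite derive1E; transitivity ('D_1 (cst 0 : R -> R) x); last exact: derive_cst.
(* The primitive based at [r] vanishes near [x], as [r] and every [z] close to [x] lie in [I]. *)
apply: near_eq_derive; near=> z => /=.
have rz : ratr r < z by near: z; exact: lt_nbhsr.
have zy2 : z < y2 by near: z; exact: lt_nbhsl.
have zI : z \in I.
  by apply: (@interval_is_interval R I (ratr r) y2) => //; rewrite !ltW.
rewrite -(orth _ _ rI zI (ltW rz)); apply: eq_Rintegral => y; rewrite inE => yz.
by rewrite /h patchE mem_set//; exact: (subset_ocitv rI zI).
Unshelve. all: by end_near. Qed.


Definition ocitv_indic (s t : R) : R -> R^o := fun x => \1_(`]s, t]%classic) x.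

Let m_oc (s t : R) : measurable (`]s, t]%classic : set (measurableTypeR R)).
Proof. exact: measurable_itv. Qed.

Lemma sq_integrable_ocitv_indic s t : L2I (ocitv_indic s t).
Proof.
have m1 : measurable_fun (setT : set (measurableTypeR R))
  (\1_(`]s, t]%classic) : measurableTypeR R -> R) by exact: measurable_indic.
pose c := `| t - s |.
suff /(@sq_integrable_le _ _ _ mu _ mI (ocitv_indic s t) c (measurable_funTS m1))[] :
  (\int[mu]_(x in [set` I]) ((ocitv_indic s t x : R) ^+ 2)%:E <= c%:E)%E by [].
have -> : (\int[mu]_(x in [set` I]) ((ocitv_indic s t x : R) ^+ 2)%:E
    = mu (`]s, t]%classic `&` [set` I]))%E.
  rewrite -integral_indic//; apply: eq_integral => x _.
  by rewrite /ocitv_indic indicE; case: (_ \in _); rewrite ?expr1n ?expr0n.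
apply: (@le_trans _ _ (mu `]s, t]%classic)).
  by apply: le_measure; rewrite ?inE//; exact: measurableI.
rewrite lebesgue_measure_itv /=; case: ifP => _; last by rewrite lee_fin normr_ge0.
by rewrite -EFinD lee_fin ler_norm.
Qed.

Lemma ip_ocitv_indic (g : R -> R^o) s t : s \in I -> t \in I ->
  ipI g (ocitv_indic s t) = \int[mu]_(x in `]s, t]) (g x : R).
Proof.
move=> sI tI; rewrite /ipL2.
have -> : `]s, t]%classic = [set` I] `&` `]s, t]%classic.
  by rewrite setIidr//; exact: subset_ocitv.
rewrite Rintegral_mkcondr; apply: eq_Rintegral => x _.
rewrite patchE /ocitv_indic indicE.
by case: (_ \in _); rewrite ?mulr1// mulr0.
Qed.

(** The length of the overlap, put in the form that polarization gives for the covariance of two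
    Brownian increments. *)
Lemma ip_ocitv_indic2 s t s' t' : s \in I -> t \in I -> s' \in I -> t' \in I ->
  s <= t -> s' <= t' -> ipI (ocitv_indic s t) (ocitv_indic s' t') =
  (`|t - s'| + `|s - t'| - `|t - t'| - `|s - s'|) / 2.
Proof.
move=> sI tI s'I t'I st s't'; rewrite ip_ocitv_indic// /Rintegral.
rewrite integral_indic; [|exact: m_oc|exact: m_oc].
have -> : `]s, t]%classic `&` `]s', t']%classic =
    `]Num.max s s', Num.min t t']%classic.
  apply/seteqP; split => x /=; rewrite !in_itv/= gt_max le_min.
    by move=> [/andP[-> ->] /andP[-> ->]].
  by move=> /andP[/andP[-> ->] /andP[-> ->]].
rewrite (_ : fine _ = fine (mu `]Num.max s s', Num.min t t']%classic))//.
rewrite lebesgue_measure_itv /= lte_fin.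
have abs (x y : R) : x <= y /\ `|x - y| = y - x \/ y <= x /\ `|x - y| = x - y.
  by case: (lerP x y) => [xy|/ltW yx]; [left|right].
have mx (x y : R) : x <= y /\ Num.max x y = y \/ y <= x /\ Num.max x y = x.
  by case: (leP x y) => [xy|/ltW yx]; [left|right].
have mn (x y : R) : x <= y /\ Num.min x y = x \/ y <= x /\ Num.min x y = y.
  by case: (leP x y) => [xy|/ltW yx]; [left|right].
case: ltP => H /=; move: H;
case: (abs t s') => -[h1 ->]; case: (abs s t') => -[h2 ->];
case: (abs t t') => -[h3 ->]; case: (abs s s') => -[h4 ->];
case: (mx s s') => -[h5 ->]; case: (mn t t') => -[h6 ->]; lra.
Qed.

Lemma step_fun_nil : step_fun [::] = 0 :> (R -> R^o).
Proof. by apply/funext => x; rewrite /step_fun big_nil. Qed.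

Lemma step_fun_cons (c s t : R) S :
  step_fun ((c, s, t) :: S) = c *: ocitv_indic s t + step_fun S.
Proof. by apply/funext => x; rewrite /step_fun big_cons. Qed.

Lemma sq_integrable_step_fun S : L2I (step_fun S).
Proof.
elim: S => [|[[c s] t] S IH]; first by rewrite step_fun_nil; exact: (sip0 HI).
by rewrite step_fun_cons; apply: (sipP HI) => //; exact: sq_integrable_ocitv_indic.
Qed.

Lemma step_in_scale (a : R) S : step_in I S ->
  exists2 S', step_in I S' & step_fun S' = a *: step_fun S.
Proof.
elim: S => [_|[[c s] t] S IH] /=.
  by exists [::] => //; rewrite step_fun_nil scaler0.
move=> /andP[st /IH[S' S'I S'E]]; exists ((a * c, s, t) :: S').
  by rewrite /= st.
by rewrite !step_fun_cons S'E scalerDr scalerA.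
Qed.

Lemma step_in_add S1 S2 : step_in I S1 -> step_in I S2 ->
  exists2 S', step_in I S' & step_fun S' = step_fun S1 + step_fun S2.
Proof.
move=> S1I S2I; exists (S1 ++ S2); first by rewrite /step_in all_cat; apply/andP.
by apply/funext => x; rewrite /step_fun big_cat.
Qed.

(* The projection [z] of [u] on the closure of the step functions satisfies
   [u - z] orthogonal to all [1_]s, t]], hence [u = z] almost everywhere. *)
Lemma step_fun_dense (u : R -> R^o) : L2I u ->
  exists2 S : nat -> seq (R * R * R), (forall k, step_in I (S k)) &
    sip_cvg ipI (fun k => step_fun (S k)) u.
Proof.
move=> Lu.
pose C := [set v | exists2 S, step_in I S & v = step_fun S].
have CL : C `<=` L2I by move=> _ [S _ ->]; exact: sq_integrable_step_fun.
have C0 : C 0 by exists [::] => //; rewrite step_fun_nil.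
have CD f g : C f -> C g -> C (f + g).
  by move=> [S SI ->] [S' S'I ->]; have [S'' ? <-] := step_in_add SI S'I; exists S''.
have CZ a f : C f -> C (a *: f).
  by move=> [S SI ->]; have [S'' ? <-] := step_in_scale a SI; exists S''.
(* The bound [M = |u|^2] comes from [2 <u, f> - |f|^2 = |u|^2 - |u - f|^2]. *)
have [|||z [Lz Hz _ [x Cx xz]]] := cone_representer (M := ipI u u) (tau := ipI u)
   HI (@complete_L2 _ _ _ mu _ mI) CL C0 CD (fun a f _ => CZ a f).
- by move=> f g Cf Cg; rewrite (ipDr HI)//; exact: CL.
- by move=> a f _ Cf; rewrite (ipZr HI)//; exact: CL.
- move=> f Cf; have := sip_ge0 HI (u - f); rewrite (ip_sqrB HI)//; last exact: CL.
  lra.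
have /choice[S SP] : forall k, exists S, step_in I S /\ x k = step_fun S.
  by move=> k; have [S' ? ?] := Cx k; exists S'.
exists S; first by move=> k; exact: (SP k).1.
have <- : x = (fun k => step_fun (S k)) by apply/funext => k; exact: (SP k).2.
have Lx k : L2I (x k) by exact/CL.
(* Here the cone is a subspace: majorization at [f] and at [- f] is equality. *)
have orth f : C f -> ipI (u - z) f = 0.
  move=> Cf; have Lf := CL _ Cf.
  have := Hz _ (CZ (-1) _ Cf); have := Hz _ Cf.
  by rewrite !(ipZr HI)// (ipBl HI)//; lra.
have Luz := sipB HI Lu Lz.
have uz0 : {ae mu, forall y, y \in I -> (u - z) y = 0}.
  apply: orthogonal_steps_ae0 => // s t sI tI st.
  rewrite -ip_ocitv_indic//; apply: orth; exists [:: (1, s, t)].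
    by rewrite /= sI tI st.
  by rewrite step_fun_cons step_fun_nil addr0 scale1r.
have uz : ipI (u - z) (u - z) = 0.
  apply: EFin_inj; rewrite -ipL2E//.
  rewrite (ae_eq_integral (cst 0%E))//; first by rewrite integral_cst// mul0e.
  - apply/measurable_EFinP; apply: measurable_funX; exact: Luz.1.
  - move: uz0; apply: (@filterS _ _ (ae_filter_ringOfSetsType mu)) => y H yI.
    by rewrite H// expr0n.
(* A vector of norm 0 is orthogonal to everything, so the limit [z] may be replaced by [u]. *)
have xkuz k : ipI (u - z) (x k - z) = 0.
  have Lxz := sipB HI (Lx k) Lz.
  have := cauchy_schwarz HI Luz Lxz; rewrite uz mul0r => h.
  by apply/eqP; rewrite -sqrf_eq0 eq_le h sqr_ge0.
move: xz; rewrite /sip_cvg; apply: cvg_trans; apply: near_eq_cvg; apply: nearW => k /=.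
have Lxz := sipB HI (Lx k) Lz.
have -> : x k - u = (x k - z) - (u - z) by rewrite opprB addrA subrK.
by rewrite [RHS](ip_sqrB HI)// (sipC HI) xkuz uz; ring.
Qed.

End step_functions.

(** * Step integrals and the Brownian isometry *)

Section white_noise_model.
Context {R : realType} {d : measure_display} {Omega : measurableType d}.
Variables (P : probability Omega R) (I : interval R) (W : R -> {RV P >-> R}) (n : R).
Hypotheses (n0 : 0 < n) (BM : brownian_motion I W).
Local Notation mu := (@lebesgue_measure R).
Local Notation L2I := (sq_integrable mu [set` I]).
Local Notation ipI := (ipL2 mu [set` I]).
Local Notation L2P := (sq_integrable P [set: Omega]).
Local Notation ipP := (ipL2 P [set: Omega]).

Let mI : measurable ([set` I] : set (measurableTypeR R)).
Proof. exact: measurable_itv. Qed.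
Let HI : semi_inner_product L2I ipI := sip_L2 mu mI.
Let HP : semi_inner_product L2P ipP := sip_L2 P measurableT.
Let one : Omega -> R^o := cst 1.
Let L1 : L2P one := sq_integrable_cst P 1.

Definition bm_incr (s t : R) : Omega -> R^o := fun w => W t w - W s w.

(** Polarization needs increments between times in any order, while the law is given for [s < t]; a
    sign change and the zero increment cover the rest. *)
Lemma bm_incr_moments s t : s \in I -> t \in I ->
  [/\ L2P (bm_incr s t), ipP (bm_incr s t) (bm_incr s t) = `|t - s| &
      ipP (bm_incr s t) one = 0].
Proof.
move=> sI tI; case: BM => _ gauss _ _.
have lt_case s' t' : s' \in I -> t' \in I -> s' < t' ->
    [/\ L2P (bm_incr s' t'), ipP (bm_incr s' t') (bm_incr s' t') = `|t' - s'| &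
      ipP (bm_incr s' t') one = 0].
  move=> s'I t'I st; pose X : {RV P >-> R} := (W t' \- W s' : {mfun Omega >-> R}).
  have st0 : 0 < t' - s' by rewrite subr_gt0.
  have sd0 : 0 < Num.sqrt (t' - s') by rewrite sqrtr_gt0.
  have PX := gauss _ _ s'I t'I st.
  have [sX XX] := @normal_sq_integrable _ _ _ P X _ sd0 PX.
  split; first exact: sX.
    by rewrite ger0_norm ?(ltW st0)// -[RHS]sqr_sqrtr ?(ltW st0).
  exact: (@normal_mean _ _ _ P X _ sd0 PX).
have [st|ts|->] := ltgtP s t; first exact: lt_case.
- have [sX XX X1] := lt_case _ _ tI sI ts.
  have -> : bm_incr s t = -1 *: bm_incr t s.
    by apply/funext => w; rewrite /bm_incr scaleN1r /= opprB.
  split; first exact: (sipZ HP).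
  + by rewrite (ipZl HP) ?(ipZr HP)//; [rewrite XX distrC; ring|exact: (sipZ HP)].
  + by rewrite (ipZl HP)// X1 mulr0.
- have -> : bm_incr t t = 0 by apply/funext => w; rewrite /bm_incr subrr.
  have L0 := sip0 HP.
  by split => //; rewrite (ip0l HP)// subrr normr0.
Qed.

(* Polarization of [E (W t - W s)^2 = |t - s|]: the independence of the
   increments is not needed. *)
Lemma ip_bm_incr s t s' t' : s \in I -> t \in I -> s' \in I -> t' \in I ->
  ipP (bm_incr s t) (bm_incr s' t') =
  (`|t - s'| + `|s - t'| - `|t - t'| - `|s - s'|) / 2.
Proof.
move=> sI tI s'I t'I.
have [Lx _ _] := bm_incr_moments sI tI; have [Ly _ _] := bm_incr_moments s'I t'I.
have [Lz <- _] := bm_incr_moments s'I sI.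
have [_ <- _] := bm_incr_moments s'I tI.
have [_ <- _] := bm_incr_moments t'I sI.
have [_ <- _] := bm_incr_moments t'I tI.
have addE (x y : Omega -> R^o) w : (x + y) w = (x w : R) + y w by [].
have subE (x y : Omega -> R^o) w : (x - y) w = (x w : R) - y w by [].
have -> : bm_incr t' t = bm_incr s t + bm_incr s' s - bm_incr s' t'.
  by apply/funext => w; rewrite ?subE ?addE /bm_incr; ring.
have -> : bm_incr s' t = bm_incr s t + bm_incr s' s.
  by apply/funext => w; rewrite addE /bm_incr; ring.
have -> : bm_incr t' s = bm_incr s' s - bm_incr s' t'.
  by apply/funext => w; rewrite ?subE ?addE /bm_incr; ring.
have Lxz := sipD HP Lx Lz.
by rewrite (ip_sqrB HP Lxz Ly) (ip_sqrB HP Lz Ly) (ipDl HP Lx Lz Ly); lra.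
Qed.

Definition noise (S : seq (R * R * R)) : Omega -> R^o :=
  \sum_(p <- S) p.1.1 *: bm_incr p.1.2 p.2.

Lemma noise_moments S : step_in I S -> L2P (noise S) /\ ipP (noise S) one = 0.
Proof.
rewrite /noise; elim: S => [_|[[c s] t] S IH] /=.
  by rewrite big_nil; split; [exact: (sip0 HP)|exact: (ip0l HP)].
move=> /andP[/and3P[sI tI _] /IH[LS S1]]; rewrite big_cons /=.
have [LX _ X1] := bm_incr_moments sI tI.
split; first exact: (sipP HP).
by rewrite (sipDZ HP)// S1 X1 mulr0 addr0.
Qed.

(** Ito's isometry on step functions, by bilinearity from two single intervals, which may
    overlap. *)
Lemma ip_noise S S' : step_in I S -> step_in I S' ->
  ipP (noise S) (noise S') = ipI (step_fun S) (step_fun S').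
Proof.
move=> + S'I.
have LS' := (noise_moments S'I).1.
have single s t : s \in I -> t \in I -> s <= t ->
    ipP (bm_incr s t) (noise S') = ipI (ocitv_indic s t) (step_fun S').
  move=> sI tI st; have [LX _ _] := bm_incr_moments sI tI.
  have LXI := sq_integrable_ocitv_indic I s t.
  elim: S' S'I {LS'} => [_|[[c s'] t'] S' IH] /=.
    rewrite /noise big_nil step_fun_nil (sipC HP) (sipC HI) (ip0l HP)// (ip0l HI)//.
  move=> /andP[/and3P[s'I t'I st'] S'I]; rewrite /noise big_cons -/(noise S') step_fun_cons /=.
  have [LX' _ _] := bm_incr_moments s'I t'I; have [LS' _] := noise_moments S'I.
  have LXI' := sq_integrable_ocitv_indic I s' t'; have LSI' := sq_integrable_step_fun I S'.
  rewrite (sipC HP) (sipC HI) (sipDZ HP)// (sipDZ HI)//.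
  rewrite !(sipC HP _ (bm_incr s t)) !(sipC HI _ (ocitv_indic s t)) IH//.
  by rewrite ip_bm_incr// ip_ocitv_indic2.
elim: S => [_|[[c s] t] S IH] /=.
  by rewrite /noise big_nil step_fun_nil (ip0l HP)// (ip0l HI)//; exact: sq_integrable_step_fun.
move=> /andP[/and3P[sI tI st] SI]; rewrite /noise big_cons -/(noise S) step_fun_cons /=.
have [LX _ _] := bm_incr_moments sI tI; have [LS _] := noise_moments SI.
have LXI := sq_integrable_ocitv_indic I s t.
have LSI := sq_integrable_step_fun I S; have LSI' := sq_integrable_step_fun I S'.
by rewrite (sipDZ HP)// (sipDZ HI)// IH// single.
Qed.

(** Splits the statistic into its mean, a multiple of the constant 1, and centered noise; these are
    orthogonal, which yields the moments. *)
Lemma step_integralE (f : R -> R^o) S : L2I f -> step_in I S ->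
  (step_integral n W f S : Omega -> R^o) =
  ipI f (step_fun S) *: one + (Num.sqrt n)^-1 *: noise S.
Proof.
move=> Lf; elim: S => [_|[[c s] t] S IH] /=.
  rewrite step_fun_nil (sipC HI) (ip0l HI)// scale0r add0r /noise big_nil scaler0.
  by apply/funext => w; rewrite /step_integral big_nil.
move=> /andP[/and3P[sI tI st] /IH E].
have LXI := sq_integrable_ocitv_indic I s t; have LSI := sq_integrable_step_fun I S.
rewrite step_fun_cons (ipDr HI) ?(ipZr HI)//; last exact: (sipZ HI).
rewrite ip_ocitv_indic// /noise big_cons -/(noise S) /=.
transitivity (c *: ((\int[mu]_(x in `]s, t]) (f x : R)) *: one +
    (Num.sqrt n)^-1 *: bm_incr s t) + (step_integral n W f S : Omega -> R^o)).
  apply/funext => w; rewrite /step_integral big_cons /=; congr (_ * _ + _).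
  by rewrite /white_noise_incr /bm_incr -[X in X + _ = _]mulr1.
rewrite E !scalerDr scalerDl !scalerA [(Num.sqrt n)^-1 * c]mulrC addrACA.
by [].
Qed.

Section step_integral_moments.
Variable f : R -> R^o.
Hypothesis Lf : L2I f.

Lemma step_integral_sq_integrable S : step_in I S ->
  L2P (step_integral n W f S : Omega -> R^o).
Proof.
move=> SI; rewrite step_integralE//; have [LS _] := noise_moments SI.
by apply: (sipP HP) => //; exact: (sipZ HP).
Qed.

Lemma step_integral_mean S : step_in I S ->
  ipP (step_integral n W f S : Omega -> R^o) one = ipI f (step_fun S).
Proof.
move=> SI; rewrite step_integralE//; have [LS S1] := noise_moments SI.
by rewrite (sipDZ HP) ?(ipZl HP)// ?S1 ?ipP_cst; [ring|exact: (sipZ HP)].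
Qed.

Lemma step_integral_cov S S' : step_in I S -> step_in I S' ->
  ipP (step_integral n W f S : Omega -> R^o) (step_integral n W f S' : Omega -> R^o) =
  ipI f (step_fun S) * ipI f (step_fun S') + ipI (step_fun S) (step_fun S') / n.
Proof.
move=> SI S'I; rewrite [X in ipP X _]step_integralE//.
have [LS S1] := noise_moments SI; have [LS' S1'] := noise_moments S'I.
have LI' := step_integral_sq_integrable S'I.
rewrite (sipDZ HP)//; last exact: (sipZ HP).
rewrite (sipC HP one) step_integral_mean// step_integralE//.
rewrite (ipZl HP) ?(ipDr HP) ?(ipZr HP)//; try exact: (sipZ HP); last first.
  by apply: (sipP HP) => //; exact: (sipZ HP).
rewrite S1 ip_noise// mulr0 add0r mulrA -expr2 exprVn sqr_sqrtr ?(ltW n0)//.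
by rewrite [n^-1 * _]mulrC.
Qed.

End step_integral_moments.

Lemma white_noise_integral_ex (f u : R -> R^o) : L2I f -> L2I u ->
  exists X, white_noise_integral n W I f u X.
Proof.
move=> Lf Lu; have [S SI Su] := step_fun_dense Lu.
have Lv k := sq_integrable_step_fun I (S k).
have [X SX] := @mean_square_limit_ex R d Omega P _ L2I ipI n f u
  (fun k => step_fun (S k)) (fun k => step_integral n W f (S k)) HI n0 Lf Lu Lv
  (fun k => step_integral_sq_integrable Lf (SI k))
  (fun k l => step_integral_cov Lf (SI k) (SI l)) Su.
by exists X, S; split => //; exact/(cvg_Lnorm2 mI Lv Lu).
Qed.

Lemma white_noise_integral_risk (f u : R -> R^o) X (c : R) : L2I f -> L2I u ->
  white_noise_integral n W I f u X ->
  ('E_P[fun w => ((X w + c) ^+ 2)%R] = ((c + ipI u f) ^+ 2 + ipI u u / n)%:E)%E.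
Proof.
move=> Lf Lu [S [SI /(cvg_Lnorm2 mI (fun k => sq_integrable_step_fun I (S k)) Lu) Su SX]].
exact: (@mean_square_limit_risk R d Omega P _ L2I ipI n f u
  (fun k => step_fun (S k)) (fun k => step_integral n W f (S k)) HI Lf Lu
  (fun k => sq_integrable_step_fun I (S k))
  (fun k => step_integral_sq_integrable Lf (SI k))
  (fun k => step_integral_mean Lf (SI k))
  (fun k l => step_integral_cov Lf (SI k) (SI l)) Su X c SX).
Qed.

Lemma L2_sq_integrable : L2 I = L2I.
Proof. by apply/seteqP; split=> f /(Lfun2E mu mI). Qed.

End white_noise_model.

(** * Gaussian sequence model *)

Section independence.
Context {R : realType} {d : measure_display} {Omega : measurableType d}.
Variable P : probability Omega R.
Local Notation L2P := (sq_integrable P [set: Omega]).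
Local Notation ipP := (ipL2 P [set: Omega]).
Let HP : semi_inner_product L2P ipP := sip_L2 P measurableT.
Let one : Omega -> R^o := cst 1.
Let L1 : L2P one := sq_integrable_cst P 1.

Lemma independent_pair (k : nat) (X : nat -> {RV P >-> R}) i j (A B : set R) :
  independent_RVs P k X -> (i < k)%N -> (j < k)%N -> i != j ->
  measurable A -> measurable B ->
  P (X i @^-1` A `&` X j @^-1` B) = (P (X i @^-1` A) * P (X j @^-1` B))%E.
Proof.
move=> ind ik jk ij mA mB.
(* With the whole line at all other indices, their factors in the product are 1. *)
pose C l := if l == i then A else if l == j then B else setT.
have mC l : measurable (C l).
  by rewrite /C; case: ifP => // _; case: ifP.
have := ind C mC.
have -> : \bigcap_(l < k) (X l @^-1` C l) = X i @^-1` A `&` X j @^-1` B.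
  apply/seteqP; split=> [w H|w [Aw Bw] l _] /=.
    have := H i ik; have := H j jk; rewrite /C /= eqxx eq_sym (negbTE ij) eqxx.
    by [].
  rewrite /C; case: eqP => [->//|_]; case: eqP => [->//|_].
  by [].
move=> ->; rewrite (bigD1 (Ordinal ik))//= (bigD1 (Ordinal jk))/=; last first.
  by rewrite -val_eqE /= eq_sym.
rewrite [in X in (_ * (_ * X))%E]big1 ?mule1.
  by rewrite /C !eqxx eq_sym (negbTE ij).
move=> l; rewrite -!val_eqE /= => /andP[li lj].
by rewrite /C (negbTE li) (negbTE lj) preimage_setT probability_setT.
Qed.

(** The joint law is the product of the marginals, and by Fubini the inner integral of [x * y] is
    [x] times the mean of [Y]. *)
Lemma independent_orthogonal (X Y : {RV P >-> R}) :
  L2P (X : Omega -> R^o) -> L2P (Y : Omega -> R^o) ->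
  ipP (Y : Omega -> R^o) one = 0 ->
  (forall A B, measurable A -> measurable B ->
     P (X @^-1` A `&` Y @^-1` B) = (P (X @^-1` A) * P (Y @^-1` B))%E) ->
  ipP (X : Omega -> R^o) Y = 0.
Proof.
move=> LX LY Y1 ind.
have iY : P.-integrable setT (EFin \o Y).
  have := sq_integrableM measurableT LY L1.
  by apply: eq_integrable => // w _ /=; rewrite mulr1.
have iXY := sq_integrableM measurableT LX LY.
pose XY w := (X w, Y w).
have mXY : measurable_fun setT XY by apply/measurable_fun_pairP; split; exact: measurable_funPT.
pose f (z : R * R) : \bar R := (z.1 * z.2)%:E.
have mf : measurable_fun setT f.
  by apply/measurable_EFinP; apply: measurable_funM; [exact: measurable_fst|exact: measurable_snd].
pose m1 := distribution P X; pose m2 := distribution P Y.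
have prodE A : measurable A -> (m1 \x m2)%E A = pushforward P XY A.
  by move=> mA; exact: product_measure_unique.
have EY : (\int[m2]_y y%:E = 0)%E.
  have E : (\int[P]_w (Y w)%:E = (ipP (Y : Omega -> R^o) one)%:E)%E.
    rewrite /ipL2 /Rintegral fineK; first by apply: eq_integral => w _; rewrite mulr1.
    exact: integrable_fin_num (sq_integrableM measurableT LY L1).
  by rewrite integral_distribution// -[RHS](congr1 EFin Y1); exact: E.
have iy : m2.-integrable setT (EFin \o id).
  by apply: (integrable_pushforward (measurable_funPT Y)) => //; exact/measurable_EFinP.
have if_ : (m1 \x m2)%E.-integrable setT f.
  apply/integrableP; split => //.
  rewrite (eq_measure_integral (pushforward P XY)); last by move=> A mA _; exact: prodE.
  by have /integrableP[] := integrable_pushforward mXY mf iXY measurableT.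
apply: EFin_inj.
have -> : (ipP (X : Omega -> R^o) Y)%:E = (\int[P]_w (f \o XY) w)%E.
  by rewrite /ipL2 /Rintegral fineK//; exact: integrable_fin_num.
rewrite -[LHS](@integral_pushforward _ _ _ _ _ _ mXY P setT f mf iXY measurableT).
rewrite (eq_measure_integral (m1 \x m2)%E); last by move=> A mA _; exact/esym/prodE.
rewrite -(integral12_prod_meas1 if_) /fubini_F.
under eq_integral.
  move=> x _; rewrite /f /=; under eq_integral do rewrite EFinM.
  rewrite integralZl// EY mule0.
  over.
by rewrite integral0.
Qed.

End independence.

Section orthonormal_sums.
Context {R : realType} {V : lmodType R}.
Variables (L : set V) (ip : V -> V -> R) (x : nat -> V).
Hypotheses (HL : semi_inner_product L ip) (Lx : forall i, L (x i)).

Lemma sip_sum (a : nat -> R) k : L (\sum_(i < k) a i *: x i).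
Proof.
elim: k => [|k IH]; first by rewrite big_ord0; exact: (sip0 HL).
by rewrite big_ord_recr /=; apply: (sipD HL) => //; exact: (sipZ HL).
Qed.

Lemma ip_suml (a : nat -> R) k y : L y ->
  ip (\sum_(i < k) a i *: x i) y = \sum_(i < k) a i * ip (x i) y.
Proof.
move=> Ly; elim: k => [|k IH]; first by rewrite !big_ord0 (ip0l HL).
have Lk := sipZ HL (a k) (Lx k).
by rewrite !big_ord_recr /= (ipDl HL) ?IH ?(ipZl HL)//; exact: sip_sum.
Qed.

(** The Kronecker symbol is kept so that noise sums and truncated weights of any lengths produce the
    same expression. *)
Lemma ip_sum2 (a b : nat -> R) k l : (forall i j, ip (x i) (x j) = (i == j)%:R) ->
  ip (\sum_(i < k) a i *: x i) (\sum_(i < l) b i *: x i) =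
  \sum_(i < k) a i * \sum_(j < l) b j * (i == j :> nat)%:R.
Proof.
move=> ortho; rewrite ip_suml; last exact: sip_sum.
apply: eq_bigr => i _; congr (_ * _); rewrite (sipC HL) ip_suml//.
by apply: eq_bigr => j _; rewrite ortho eq_sym.
Qed.

End orthonormal_sums.

(** * Partial sums and truncated weights *)

Section gaussian_sequence_model.
Context {R : realType} {d : measure_display} {Omega : measurableType d}.
Variables (P : probability Omega R) (eps : nat -> {RV P >-> R}) (n : R).
Hypotheses (n0 : 0 < n) (Heps : iid_standard_normal eps).
Local Notation counting := (@counting nat R).
Local Notation L2N := (sq_integrable counting [set: nat]).
Local Notation ipN := (ipL2 counting [set: nat]).
Local Notation L2P := (sq_integrable P [set: Omega]).
Local Notation ipP := (ipL2 P [set: Omega]).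

Let mN : measurable [set: nat] := measurableT.
Let HN : semi_inner_product L2N ipN := sip_L2 counting mN.
Let HP : semi_inner_product L2P ipP := sip_L2 P measurableT.
Let one : Omega -> R^o := cst 1.
Let L1 : L2P one := sq_integrable_cst P 1.

Let X i : Omega -> R^o := eps i.

Lemma std_normal_moments i : [/\ L2P (X i), ipP (X i) (X i) = 1 & ipP (X i) one = 0].
Proof.
have PX := Heps.1 i.
have [sX XX] := @normal_sq_integrable _ _ _ P (eps i) 1 ltr01 PX.
split => //; first by rewrite XX expr1n.
exact: (@normal_mean _ _ _ P (eps i) 1 ltr01 PX).
Qed.

Let LX i : L2P (X i). Proof. by have [LXi _ _] := std_normal_moments i. Qed.

Lemma ip_std_normal i j : ipP (X i) (X j) = (i == j)%:R.
Proof.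
have [->|ij] := eqVneq i j; first by have [_ -> _] := std_normal_moments j.
have [_ _ Xj1] := std_normal_moments j.
apply: (independent_orthogonal (LX i) (LX j) Xj1) => A B mA mB.
apply: (independent_pair (Heps.2 (maxn i j).+1)) => //.
- by rewrite ltnS leq_maxl.
- by rewrite ltnS leq_maxr.
Qed.

Definition unit_seq (i : nat) : nat -> R^o := \1_[set i].

Let counting1 i : counting [set i] = 1%E.
Proof. by rewrite /counting asboolT// fset_set1 finmap.cardfs1. Qed.

Let unit_seqE i j : unit_seq i j = (j == i)%:R :> R.
Proof. by rewrite /unit_seq indicE in_set1. Qed.

Let mfN (f : nat -> R) : measurable_fun [set: nat] f.
Proof. by []. Qed.

Lemma sq_integrable_unit_seq i : L2N (unit_seq i).
Proof.
suff /(sq_integrable_le mN (mfN (unit_seq i)))[] :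
  (\int[counting]_(x in [set: nat]) ((unit_seq i x : R) ^+ 2)%:E <= 1%:E)%E by [].
rewrite -(counting1 i) -[X in (_ <= counting X)%E]setIT -integral_indic//.
rewrite le_eqVlt; apply/orP; left; apply/eqP; apply: eq_integral => x _.
by rewrite unit_seqE indicE in_set1; case: (_ == _); rewrite ?expr1n ?expr0n.
Qed.

Let Le := sq_integrable_unit_seq.

Lemma ip_unit_seq (f : nat -> R^o) i : ipN f (unit_seq i) = f i.
Proof.
rewrite /ipL2; transitivity (\int[counting]_(x in [set: nat]) ((f : nat -> R) \_ [set i]) x).
  apply: eq_Rintegral => x _; rewrite patchE in_set1 unit_seqE.
  by case: (_ == _); rewrite ?mulr1 ?mulr0.
rewrite -Rintegral_mkcondr setTI.
transitivity (\int[counting]_(x in [set i]) (f i : R)).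
  by apply: eq_Rintegral => x; rewrite inE => ->.
rewrite Rintegral_cst// -[RHS]mulr1; congr (_ * _).
exact: (congr1 fine (counting1 i)).
Qed.

Lemma ip_unit_seq2 i j : ipN (unit_seq i) (unit_seq j) = (i == j)%:R.
Proof. by rewrite ip_unit_seq unit_seqE eq_sym. Qed.

Definition truncation (u : nat -> R^o) k : nat -> R^o := \sum_(i < k) u i *: unit_seq i.

Lemma sq_integrable_truncation u k : L2N (truncation u k).
Proof. exact: (sip_sum HN Le). Qed.

Lemma ip_truncation (f u : nat -> R^o) k : L2N f ->
  ipN f (truncation u k) = \sum_(i < k) (u i : R) * f i.
Proof.
move=> Lf; rewrite (sipC HN) (ip_suml HN Le)//.
by apply: eq_bigr => i _; rewrite (sipC HN) ip_unit_seq.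
Qed.

(** The squared distance is [|u|^2] minus the partial sum of the [u i ^+ 2], and the integral
    against the counting measure is the sum of that series. *)
Lemma truncation_cvg (u : nat -> R^o) : L2N u -> sip_cvg ipN (truncation u) u.
Proof.
move=> Lu; rewrite /sip_cvg.
have E k : ipN (truncation u k - u) (truncation u k - u) =
    ipN u u - \sum_(i < k) (u i : R) ^+ 2.
  have Lt := sq_integrable_truncation u k.
  rewrite (ip_sqrB HN)// (sipC HN (truncation u k) u) (ip_truncation u k Lu).
  rewrite /truncation (ip_sum2 HN Le _ _ _ _ ip_unit_seq2).
  have -> : \sum_(i < k) (u i : R) * (\sum_(j < k) (u j : R) * (i == j :> nat)%:R) =
      \sum_(i < k) (u i : R) ^+ 2.
    apply: eq_bigr => i _; rewrite (bigD1 i)//= eqxx mulr1 big1 ?addr0// => j ji.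
    by rewrite eq_sym (negbTE (ji : (j : nat) != i)) mulr0.
  under [X in _ - 2 * X + _]eq_bigr do rewrite -expr2.
  ring.
under eq_fun do rewrite E.
have u_sum : \sum_(i < k) (u i : R) ^+ 2 @[k --> \oo] --> ipN u u; last first.
  have := cvgB (cvg_cst (ipN u u)) u_sum; rewrite subrr; exact.
have u0 k : (0 <= ((u k : R) ^+ 2)%:E)%E by rewrite lee_fin sqr_ge0.
have : (\sum_(0 <= i < k) ((u i : R) ^+ 2)%:E)%E @[k --> \oo] --> (ipN u u)%:E.
  rewrite -(ipL2E mN Lu) ge0_integral_count//.
  exact: is_cvg_nneseries.
move=> /fine_cvgP[_]; apply: cvg_trans; apply: near_eq_cvg; apply: nearW => k /=.
by rewrite sumEFin /= big_mkord.
Qed.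

Let Z (f u : nat -> R^o) k : Omega -> R^o :=
  fun w => \sum_(i < k) (u i : R) * sequence_obs n eps f i w.

Let noiseS (u : nat -> R^o) k : Omega -> R^o := \sum_(i < k) u i *: X i.

Let LS u k : L2P (noiseS u k). Proof. exact: (sip_sum HP LX). Qed.

Lemma sequence_sumE (f u : nat -> R^o) k : L2N f ->
  Z f u k = ipN f (truncation u k) *: one + (Num.sqrt n)^-1 *: noiseS u k.
Proof.
move=> Lf; rewrite ip_truncation//; apply/funext => w.
rewrite /Z /noiseS.
elim: k => [|k IH].
  by rewrite !big_ord0 scale0r scaler0 addr0.
rewrite !big_ord_recr /= IH.
set S := \sum_(i < k) u i *: X i.
rewrite /sequence_obs.
(* Both [transitivity] steps hold by conversion: they unfold operations on functions at [w] into
   real ones, for [ring]. *)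
transitivity ((\sum_(i < k) (u i : R) * f i) * 1 + (Num.sqrt n)^-1 * (S w : R) +
   (u k : R) * ((f k : R) + (Num.sqrt n)^-1 * eps k w)); first by [].
transitivity ((\sum_(i < k) (u i : R) * f i + (u k : R) * f k) * 1 +
  (Num.sqrt n)^-1 * ((S w : R) + (u k : R) * eps k w)); last by [].
ring.
Qed.

Lemma sequence_sum_sq_integrable f u k : L2N f -> L2P (Z f u k).
Proof.
by move=> Lf; rewrite sequence_sumE//; apply: (sipP HP) => //; exact: (sipZ HP).
Qed.

Let noise1 u k : ipP (noiseS u k) one = 0.
Proof.
rewrite (ip_suml HP LX)// big1// => i _.
by have [_ _ ->] := std_normal_moments i; rewrite mulr0.
Qed.

Lemma sequence_sum_mean f u k : L2N f -> ipP (Z f u k) one = ipN f (truncation u k).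
Proof.
move=> Lf; rewrite sequence_sumE// (sipDZ HP)//; last exact: (sipZ HP).
by rewrite (ipZl HP)// noise1 ipP_cst; ring.
Qed.

Lemma sequence_sum_cov f u k l : L2N f ->
  ipP (Z f u k) (Z f u l) = ipN f (truncation u k) * ipN f (truncation u l) +
    ipN (truncation u k) (truncation u l) / n.
Proof.
move=> Lf; rewrite [X in ipP X _]sequence_sumE//.
have LZ := sequence_sum_sq_integrable u l Lf.
have Lrn m := sipZ HP (Num.sqrt n)^-1 (LS u m).
rewrite (sipDZ HP)// (sipC HP one) sequence_sum_mean// sequence_sumE//.
have La := sipZ HP (ipN f (truncation u l)) L1.
rewrite (ipZl HP)//; last exact: (sipD HP).
rewrite (ipDr HP)// !(ipZr HP)// noise1.
rewrite /noiseS /truncation (ip_sum2 HP LX _ _ _ _ ip_std_normal).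
rewrite (ip_sum2 HN Le _ _ _ _ ip_unit_seq2).
rewrite mulr0 add0r mulrA -expr2 exprVn sqr_sqrtr ?(ltW n0)//.
by rewrite [n^-1 * _]mulrC.
Qed.

Lemma sequence_sum_ex (f u : nat -> R^o) : L2N f -> L2N u ->
  exists X, sequence_sum n eps f u X.
Proof.
move=> Lf Lu.
exact: (@mean_square_limit_ex R d Omega P _ L2N ipN n f u (truncation u) (Z f u)
  HN n0 Lf Lu (sq_integrable_truncation u)
  (fun k => sequence_sum_sq_integrable u k Lf)
  (fun k l => sequence_sum_cov u k l Lf) (truncation_cvg Lu)).
Qed.

Lemma sequence_sum_risk (f u : nat -> R^o) Y (c : R) : L2N f -> L2N u ->
  sequence_sum n eps f u Y ->
  ('E_P[fun w => ((Y w + c) ^+ 2)%R] = ((c + ipN u f) ^+ 2 + ipN u u / n)%:E)%E.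
Proof.
move=> Lf Lu SY.
exact: (@mean_square_limit_risk R d Omega P _ L2N ipN n f u (truncation u) (Z f u)
  HN Lf Lu (sq_integrable_truncation u)
  (fun k => sequence_sum_sq_integrable u k Lf)
  (fun k => sequence_sum_mean u k Lf)
  (fun k l => sequence_sum_cov u k l Lf) (truncation_cvg Lu) Y c SY).
Qed.

Lemma ell2_sq_integrable : ell2 = L2N.
Proof.
apply/seteqP; split=> f.
  by move=> Lf; apply/(Lfun2E counting mN); rewrite patch_setT.
by move=> /(Lfun2E counting mN); rewrite patch_setT.
Qed.

Lemma ell2normE (f : nat -> R^o) : L2N f -> ell2norm f = (Num.sqrt (ipN f f))%:E.
Proof. by move=> Lf; rewrite -(Lnorm2E mN Lf) patch_setT. Qed.

End gaussian_sequence_model.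

(** * The white noise and sequence models as instances of the abstract bounds *)

Theorem corollary1 (R : realType) (n : R) (n_gt0 : 0 < n)
    (d : measure_display) (Omega : measurableType d)
    (P : probability Omega R) :
  (forall (I : interval R) (W : R -> {RV P >-> R})
      (D F : set (R -> R^o)) (T : (R -> R^o) -> R),
    brownian_motion I W ->
    linear_functional_on D T ->
    F !=set0 -> F `<=` D -> F `<=` L2 I ->
    let risk :=
      minimax_affine_risk (L2 I) (white_noise_integral n W I) T F in
    let omega e := modulus (L2norm I) T e (convex_hull F) in
    risk = ereal_sup
      [set (omega e ^+ 2 * (((4 * n)^-1) / (n^-1 + e ^+ 2 / 4))%:E)%E
        | e in [set e : R | 0 < e]] /\
    ((8^-1)%:E * omega (2 / Num.sqrt n)%R ^+ 2 <= risk)%E /\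
    (risk <= (4^-1)%:E * omega (2 / Num.sqrt n)%R ^+ 2)%E) /\
  (forall (eps : nat -> {RV P >-> R})
      (D F : set (nat -> R^o)) (T : (nat -> R^o) -> R),
    iid_standard_normal eps ->
    linear_functional_on D T ->
    F !=set0 -> F `<=` D -> F `<=` ell2 ->
    let risk :=
      minimax_affine_risk ell2 (sequence_sum n eps) T F in
    let omega e := modulus ell2norm T e (convex_hull F) in
    risk = ereal_sup
      [set (omega e ^+ 2 * (((4 * n)^-1) / (n^-1 + e ^+ 2 / 4))%:E)%E
        | e in [set e : R | 0 < e]] /\
    ((8^-1)%:E * omega (2 / Num.sqrt n)%R ^+ 2 <= risk)%E /\
    (risk <= (4^-1)%:E * omega (2 / Num.sqrt n)%R ^+ 2)%E).
Proof.
split.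
- move=> I W D F T BM lT F0 FD FL risk omega.
  have mI : measurable ([set` I] : set (measurableTypeR R)) by exact: measurable_itv.
  have HI := sip_L2 (@lebesgue_measure R) mI.
  have cI := @complete_L2 _ _ _ (@lebesgue_measure R) _ mI.
  rewrite /risk /omega; move: FL; rewrite (L2_sq_integrable I) => FL.
  have nE (f : R -> R^o) : sq_integrable (@lebesgue_measure R) [set` I] f ->
      L2norm I f = (Num.sqrt (ipL2 (@lebesgue_measure R) [set` I] f f))%:E.
    exact: (Lnorm2E mI).
  have rk f u X c := @white_noise_integral_risk R d Omega P I W n n_gt0 BM f u X c.
  have ex f u := @white_noise_integral_ex R d Omega P I W n n_gt0 BM f u.
  split; last split.
  + exact: (minimax_affine_riskE n_gt0 HI cI nE rk ex lT F0 FD FL).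
  + exact: (minimax_affine_risk_lower n_gt0 HI cI nE rk ex lT F0 FD FL).
  + exact: (minimax_affine_risk_upper n_gt0 HI cI nE rk ex lT F0 FD FL).
- move=> eps D F T Heps lT F0 FD FL risk omega.
  have mN : measurable [set: nat] by exact: measurableT.
  have HN := sip_L2 (@counting nat R) mN.
  have cN := @complete_L2 _ _ _ (@counting nat R) _ mN.
  rewrite /risk /omega; move: FL; rewrite ell2_sq_integrable => FL.
  have rk f u X c := @sequence_sum_risk R d Omega P eps n n_gt0 Heps f u X c.
  have ex f u := @sequence_sum_ex R d Omega P eps n n_gt0 Heps f u.
  split; last split.
  + exact: (minimax_affine_riskE n_gt0 HN cN (@ell2normE R) rk ex lT F0 FD FL).
  + exact: (minimax_affine_risk_lower n_gt0 HN cN (@ell2normE R) rk ex lT F0 FD FL).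
  + exact: (minimax_affine_risk_upper n_gt0 HN cN (@ell2normE R) rk ex lT F0 FD FL).
Qed.
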